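(* Let $L$ be a finite dimensional Lie algebra over a field $k$, let $U(L)$ be its universal enveloping algebra and $I\subset U(L)$ the augmentation ideal. If the graded Rees algebra $U(L)^*=\bigoplus_{n\ge 0}I^n$ is graded left Noetherian, then the natural functor $$\Phi_L: D^b\big((U(L)\text{-mod})_I\big)\to D^b_I(U(L)\text{-mod})$$ is an equivalence.
   Context: The Rees algebra is $U(L)^*=\bigoplus_{n\ge 0}I^n=U(L)\oplus I\oplus I^2\oplus\cdots$ (with $I^0=U(L)$), graded by $n$, with multiplication given by the products $I^m\times I^n\to I^{m+n}$ in $U(L)$. Graded left Noetherian means that every graded left ideal is finitely generated. $U(L)\text{-mod}$ denotes the abelian category of finitely generated left $U(L)$-modules. A left $U(L)$-module $M$ is $I$-torsion if for every $m\in M$ there is $n>0$ with $I^nm=0$; $(U(L)\text{-mod})_I\subset U(L)\text{-mod}$ is the full Serre subcategory of $I$-torsion modules. $D^b_I(U(L)\text{-mod})\subset D^b(U(L)\text{-mod})$ is the full triangulated subcategory of complexes whose cohomology modules are all $I$-torsion. $\Phi_L$ is the obvious functor induced by the inclusion of $(U(L)\text{-mod})_I$ into $U(L)\text{-mod}$. *)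

(* Defs.v *)
From HB Require Import structures.
From mathcomp Require Import all_boot all_order all_algebra.
From mathcomp Require Import boolp classical_sets.

Set Implicit Arguments.
Unset Strict Implicit.
Unset Printing Implicit Defensive.

Import GRing.Theory.
Local Open Scope ring_scope.
Local Open Scope quotient_scope.

HB.mixin Record isLie (k : fieldType) L of GRing.Lmodule k L := {
  lie : L -> L -> L;
  lie_linearl : forall y, linear (lie^~ y);
  lie_linearr : forall x, linear (lie x);
  lie_alt : forall x, lie x x = 0;
  lie_jacobi : forall x y z,
    lie x (lie y z) + lie y (lie z x) + lie z (lie x y) = 0
}.

#[short(type="lieAlgType")]
HB.structure Definition LieAlgebra (k : fieldType) :=
  {L of GRing.Lmodule k L & isLie k L}.

#[short(type="finDimLieAlgType")]
HB.structure Definition FinDimLieAlgebra (k : fieldType) :=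
  {L of Vector k L & isLie k L}.

(** U(L) is the unital associative k-algebra generated by the vector space L
    subject to [x, y] = x y - y x.  It is built as the set of formal algebra
    expressions in elements of L modulo the least congruence [ueq] containing
    the k-algebra axioms, the linearity of L -> U(L) and the relation above;
    the universal property is [uea_liftP] and [uea_lift_unique] below. *)
Section UEA.
Context {k : fieldType} (L : lieAlgType k).

Inductive uterm : Type :=
  | UConst of k
  | UGen of L
  | UAdd of uterm & uterm
  | UMul of uterm & uterm.

Inductive ueq : uterm -> uterm -> Prop :=
  | ueq_refl t : ueq t t
  | ueq_sym t u : ueq t u -> ueq u t
  | ueq_trans t u v : ueq t u -> ueq u v -> ueq t v
  | ueq_add t t' u u' : ueq t t' -> ueq u u' -> ueq (UAdd t u) (UAdd t' u')
  | ueq_mul t t' u u' : ueq t t' -> ueq u u' -> ueq (UMul t u) (UMul t' u')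
  | ueq_addA t u v : ueq (UAdd t (UAdd u v)) (UAdd (UAdd t u) v)
  | ueq_addC t u : ueq (UAdd t u) (UAdd u t)
  | ueq_add0 t : ueq (UAdd (UConst 0) t) t
  | ueq_addN t : ueq (UAdd (UMul (UConst (-1)) t) t) (UConst 0)
  | ueq_mulA t u v : ueq (UMul t (UMul u v)) (UMul (UMul t u) v)
  | ueq_mul1l t : ueq (UMul (UConst 1) t) t
  | ueq_mul1r t : ueq (UMul t (UConst 1)) t
  | ueq_mulDl t u v : ueq (UMul (UAdd t u) v) (UAdd (UMul t v) (UMul u v))
  | ueq_mulDr t u v : ueq (UMul t (UAdd u v)) (UAdd (UMul t u) (UMul t v))
  | ueq_constC a t : ueq (UMul (UConst a) t) (UMul t (UConst a))
  | ueq_constD a b : ueq (UConst (a + b)) (UAdd (UConst a) (UConst b))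
  | ueq_constM a b : ueq (UConst (a * b)) (UMul (UConst a) (UConst b))
  | ueq_genD x y : ueq (UGen (x + y)) (UAdd (UGen x) (UGen y))
  | ueq_genZ a x : ueq (UGen (a *: x)) (UMul (UConst a) (UGen x))
  | ueq_lie x y : ueq (UGen (lie x y))
      (UAdd (UMul (UGen x) (UGen y))
            (UMul (UConst (-1)) (UMul (UGen y) (UGen x)))).

HB.instance Definition _ := gen_eqMixin uterm.
HB.instance Definition _ := gen_choiceMixin uterm.

Definition ueqb (t u : uterm) : bool := `[< ueq t u >].

Lemma ueqb_equiv : equiv_class_of ueqb.
Proof.
split=> [t|t u|u t v].
- exact/asboolP/ueq_refl.
- by apply/asboolP/asboolP => /ueq_sym.
- by move=> /asboolP tu /asboolP uv; exact/asboolP/(ueq_trans tu uv).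
Qed.
Canonical ueqb_equivRel := EquivRelPack ueqb_equiv.
Canonical ueqb_encModRel := defaultEncModRel ueqb.

Definition UEA := {eq_quot ueqb}.
HB.instance Definition _ := Choice.on UEA.
HB.instance Definition _ : EqQuotient uterm ueqb UEA := EqQuotient.on UEA.

Definition upi (t : uterm) : UEA := \pi_UEA t.

Lemma upiP t u : upi t = upi u <-> ueq t u.
Proof. by rewrite /upi; split=> [/eqmodP/asboolP|tu]; last exact/eqmodP/asboolP. Qed.

Lemma upi_repr (a : UEA) : upi (repr a) = a.
Proof. exact: reprK. Qed.

Lemma ueq_repr t : ueq (repr (upi t)) t.
Proof. by apply/upiP; rewrite upi_repr. Qed.

Definition uea_add (a b : UEA) := upi (UAdd (repr a) (repr b)).
Definition uea_opp (a : UEA) := upi (UMul (UConst (-1)) (repr a)).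
Definition uea_mul (a b : UEA) := upi (UMul (repr a) (repr b)).
Definition uea_scale (c : k) (a : UEA) := upi (UMul (UConst c) (repr a)).

Lemma upiD t u : uea_add (upi t) (upi u) = upi (UAdd t u).
Proof. by apply/upiP/ueq_add; exact: ueq_repr. Qed.

Lemma upiM t u : uea_mul (upi t) (upi u) = upi (UMul t u).
Proof. by apply/upiP/ueq_mul; exact: ueq_repr. Qed.

Lemma upiN t : uea_opp (upi t) = upi (UMul (UConst (-1)) t).
Proof. by apply/upiP/ueq_mul; [exact: ueq_refl | exact: ueq_repr]. Qed.

Lemma upiZ c t : uea_scale c (upi t) = upi (UMul (UConst c) t).
Proof. by apply/upiP/ueq_mul; [exact: ueq_refl | exact: ueq_repr]. Qed.

Lemma upiW (P : UEA -> Prop) : (forall t, P (upi t)) -> forall a, P a.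
Proof. by move=> h a; rewrite -(upi_repr a). Qed.

Fixpoint ueval (A : algType k) (f : L -> A) (t : uterm) : A :=
  match t with
  | UConst c => c%:A
  | UGen x => f x
  | UAdd t u => ueval f t + ueval f u
  | UMul t u => ueval f t * ueval f u
  end.

Definition lie_morphism (A : algType k) (f : L -> A) : Prop :=
  forall x y, f (lie x y) = f x * f y - f y * f x.

Lemma ueval_ueq (A : algType k) (f : {linear L -> A}) :
  lie_morphism f -> forall t u, ueq t u -> ueval f t = ueval f u.
Proof.
move=> fL t u; elim=> //=.
- by move=> ? ? ? _ -> _ ->.
- by move=> ? ? ? ? _ -> _ ->.
- by move=> ? ? ? ? _ -> _ ->.
- by move=> *; rewrite addrA.
- by move=> *; rewrite addrC.
- by move=> *; rewrite scale0r add0r.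
- by move=> *; rewrite scaleN1r mulN1r addNr scale0r.
- by move=> *; rewrite mulrA.
- by move=> *; rewrite scale1r mul1r.
- by move=> *; rewrite scale1r mulr1.
- by move=> *; rewrite mulrDl.
- by move=> *; rewrite mulrDr.
- by move=> *; rewrite mulr_algl mulr_algr.
- by move=> *; rewrite scalerDl.
- by move=> *; rewrite mulr_algl scalerA.
- by move=> *; rewrite linearD.
- by move=> *; rewrite linearZ /= mulr_algl.
- by move=> x y; rewrite fL scaleN1r mulN1r.
Qed.

Fact uea_addA : associative uea_add.
Proof.
elim/upiW=> t; elim/upiW=> u; elim/upiW=> v.
by rewrite !upiD; apply/upiP/ueq_addA.
Qed.
Fact uea_addC : commutative uea_add.
Proof. by elim/upiW=> t; elim/upiW=> u; rewrite !upiD; apply/upiP/ueq_addC. Qed.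
Fact uea_add0 : left_id (upi (UConst 0)) uea_add.
Proof. by elim/upiW=> t; rewrite !upiD; apply/upiP/ueq_add0. Qed.
Fact uea_addN : left_inverse (upi (UConst 0)) uea_opp uea_add.
Proof. by elim/upiW=> t; rewrite upiN !upiD; apply/upiP/ueq_addN. Qed.
Fact uea_mulA : associative uea_mul.
Proof.
elim/upiW=> t; elim/upiW=> u; elim/upiW=> v.
by rewrite !upiM; apply/upiP/ueq_mulA.
Qed.
Fact uea_mul1l : left_id (upi (UConst 1)) uea_mul.
Proof. by elim/upiW=> t; rewrite !upiM; apply/upiP/ueq_mul1l. Qed.
Fact uea_mul1r : right_id (upi (UConst 1)) uea_mul.
Proof. by elim/upiW=> t; rewrite !upiM; apply/upiP/ueq_mul1r. Qed.
Fact uea_mulDl : left_distributive uea_mul uea_add.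
Proof.
elim/upiW=> t; elim/upiW=> u; elim/upiW=> v.
by rewrite !(upiM, upiD); apply/upiP/ueq_mulDl.
Qed.
Fact uea_mulDr : right_distributive uea_mul uea_add.
Proof.
elim/upiW=> t; elim/upiW=> u; elim/upiW=> v.
by rewrite !(upiM, upiD); apply/upiP/ueq_mulDr.
Qed.
Fact uea_1_neq0 : upi (UConst 1) != upi (UConst 0).
Proof.
have z_lie : lie_morphism (\0 : {linear L -> k^o}).
  by move=> x y /=; rewrite mul0r subrr.
apply/eqP => /upiP /(ueval_ueq z_lie) /=.
by rewrite scale1r scale0r => /eqP; rewrite oner_eq0.
Qed.

HB.instance Definition _ := GRing.isNzRing.Build UEA
  uea_addA uea_addC uea_add0 uea_addN uea_mulA uea_mul1l uea_mul1r
  uea_mulDl uea_mulDr uea_1_neq0.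

Lemma upi_add t u : upi t + upi u = upi (UAdd t u).
Proof. exact: upiD. Qed.
Lemma upi_mul t u : upi t * upi u = upi (UMul t u).
Proof. exact: upiM. Qed.

Fact uea_scalerA c d (a : UEA) :
  uea_scale c (uea_scale d a) = uea_scale (c * d) a.
Proof.
elim/upiW: a => t; rewrite !upiZ; apply/upiP.
apply: ueq_trans (ueq_mulA _ _ _) _; apply: ueq_mul (ueq_refl _).
exact/ueq_sym/ueq_constM.
Qed.
Fact uea_scale1r : left_id 1 uea_scale.
Proof. by elim/upiW=> t; rewrite !upiZ; apply/upiP/ueq_mul1l. Qed.
Fact uea_scalerDr : right_distributive uea_scale +%R.
Proof.
move=> c; elim/upiW=> t; elim/upiW=> u.
by rewrite !(upiZ, upi_add); apply/upiP/ueq_mulDr.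
Qed.
Fact uea_scalerDl (a : UEA) : {morph uea_scale^~ a : c d / c + d}.
Proof.
move=> c d /=; elim/upiW: a => t; rewrite !(upiZ, upi_add); apply/upiP.
apply: ueq_trans (ueq_mulDl _ _ _); apply: ueq_mul (ueq_refl _).
exact: ueq_constD.
Qed.

HB.instance Definition _ := GRing.Zmodule_isLmodule.Build k UEA
  uea_scalerA uea_scale1r uea_scalerDr uea_scalerDl.

Lemma upi_scale c t : c *: upi t = upi (UMul (UConst c) t).
Proof. exact: upiZ. Qed.

Fact uea_scalerAl c (a b : UEA) : c *: (a * b) = (c *: a) * b.
Proof.
elim/upiW: a => t; elim/upiW: b => u.
by rewrite !(upi_mul, upi_scale); apply/upiP/ueq_mulA.
Qed.

HB.instance Definition _ := GRing.Lmodule_isLalgebra.Build k UEA uea_scalerAl.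

Fact uea_scalerAr c (a b : UEA) : c *: (a * b) = a * (c *: b).
Proof.
elim/upiW: a => t; elim/upiW: b => u; rewrite !(upi_mul, upi_scale); apply/upiP.
apply: ueq_trans (ueq_mulA _ _ _) _; apply: ueq_trans (ueq_sym (ueq_mulA _ _ _)).
exact: ueq_mul (ueq_constC _ _) (ueq_refl _).
Qed.

HB.instance Definition _ := GRing.Lalgebra_isAlgebra.Build k UEA uea_scalerAr.

Definition uea_inj (x : L) : UEA := upi (UGen x).

Fact uea_inj_linear : linear uea_inj.
Proof.
move=> c x y; rewrite /uea_inj !(upi_scale, upi_add).
apply/upiP; apply: ueq_trans (ueq_genD _ _) _.
exact: ueq_add (ueq_genZ _ _) (ueq_refl _).
Qed.
HB.instance Definition _ :=
  GRing.isLinear.Build k L UEA *:%R uea_inj uea_inj_linear.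

Lemma uea_inj_lie : lie_morphism uea_inj.
Proof.
move=> x y; rewrite -scaleN1r /uea_inj; rewrite 2!upi_mul upi_scale upi_add.
exact/upiP/ueq_lie.
Qed.

Definition uea_lift (A : algType k) (f : {linear L -> A})
  (fL : lie_morphism f) (a : UEA) : A := ueval f (repr a).

Section Lift.
Variables (A : algType k) (f : {linear L -> A}) (fL : lie_morphism f).

Lemma uea_lift_upi t : uea_lift fL (upi t) = ueval f t.
Proof. exact: ueval_ueq fL _ _ (ueq_repr t). Qed.

Fact uea_lift_linear : linear (uea_lift fL).
Proof.
move=> c; elim/upiW=> t; elim/upiW=> u.
rewrite !(upi_scale, upi_add) !uea_lift_upi /=.
by rewrite mulr_algl.
Qed.
HB.instance Definition _ :=
  GRing.isLinear.Build k UEA A *:%R (uea_lift fL) uea_lift_linear.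

Fact uea_lift_monoid_morphism : monoid_morphism (uea_lift fL).
Proof.
split; first by rewrite [LHS]uea_lift_upi /= scale1r.
elim/upiW=> t; elim/upiW=> u.
by rewrite upi_mul !uea_lift_upi.
Qed.
HB.instance Definition _ :=
  GRing.isMonoidMorphism.Build UEA A (uea_lift fL) uea_lift_monoid_morphism.

Lemma uea_liftP x : uea_lift fL (uea_inj x) = f x.
Proof. exact: uea_lift_upi. Qed.

Lemma uea_lift_unique (g : {lrmorphism UEA -> A}) :
  (forall x, g (uea_inj x) = f x) -> g =1 uea_lift fL.
Proof.
move=> gf; elim/upiW=> t; rewrite uea_lift_upi.
elim: t => [c|x|t IHt u IHu|t IHt u IHu] /=.
- have -> : upi (UConst c) = c%:A.
    by rewrite [RHS]upi_scale; exact/upiP/ueq_sym/ueq_mul1r.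
  by rewrite linearZ rmorph1.
- exact: gf.
- by rewrite -IHt -IHu -rmorphD; congr (g _); rewrite upi_add.
- by rewrite -IHt -IHu -rmorphM; congr (g _); rewrite upi_mul.
Qed.
End Lift.

Fact null_lie_morphism : lie_morphism (\0 : {linear L -> k^o}).
Proof. by move=> x y /=; rewrite mul0r subrr. Qed.

(* The augmentation U(L) -> k, the algebra morphism killing L. *)
Definition uea_aug : {lrmorphism UEA -> k^o} := uea_lift null_lie_morphism.

End UEA.

Record ideal (R : nzRingType) := Ideal {
  ideal_set :> set R;
  ideal_0 : ideal_set 0;
  ideal_D : forall a b, ideal_set a -> ideal_set b -> ideal_set (a + b);
  ideal_Ml : forall a b, ideal_set b -> ideal_set (a * b);
  ideal_Mr : forall a b, ideal_set a -> ideal_set (a * b)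
}.

Section Powers.
Variable R : nzRingType.

Definition ideal_mul (A B : set R) : set R :=
  [set x | exists s : seq (R * R),
     (forall p, p \in s -> A p.1 /\ B p.2) /\ x = \sum_(p <- s) p.1 * p.2].

Fixpoint ideal_exp (I : set R) (n : nat) : set R :=
  if n is n'.+1 then ideal_mul I (ideal_exp I n') else setT.

Variable I : ideal R.

Lemma ideal_exp0 n : ideal_exp I n 0.
Proof. by case: n => [|n] //=; exists [::]; rewrite big_nil. Qed.

Lemma ideal_expD n a b :
  ideal_exp I n a -> ideal_exp I n b -> ideal_exp I n (a + b).
Proof.
case: n => [|n] //= [s [sI ->]] [t [tI ->]]; exists (s ++ t).
by rewrite big_cat; split=> // p; rewrite mem_cat => /orP[/sI|/tI].
Qed.

Lemma ideal_exp_mulr m n a b :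
  ideal_exp I m a -> ideal_exp I n b -> ideal_exp I (m + n) (a * b).
Proof.
elim: m a => [|m IHm] a.
  rewrite add0n => _; case: n => [|n] //= [s [sI ->]].
  exists [seq (a * p.1, p.2) | p <- s]; split.
    by move=> _ /mapP[p /sI[p1 p2] ->]; split=> //=; apply: ideal_Ml.
  by rewrite big_map mulr_sumr; apply: eq_bigr => p _; rewrite mulrA.
move=> [s [sI ->]] bI; exists [seq (p.1, p.2 * b) | p <- s]; split.
  by move=> _ /mapP[p /sI[p1 p2] ->]; split=> //=; apply: IHm.
by rewrite big_map mulr_suml; apply: eq_bigr => p _; rewrite mulrA.
Qed.

Lemma ideal_expN n a : ideal_exp I n a -> ideal_exp I n (- a).
Proof. by move=> aI; rewrite -mulN1r; apply: (@ideal_exp_mulr 0). Qed.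

Lemma ideal_exp_sum n (J : Type) (r : seq J) (P : pred J) (F : J -> R) :
  (forall j, P j -> ideal_exp I n (F j)) ->
  ideal_exp I n (\sum_(j <- r | P j) F j).
Proof.
by move=> FI; apply: (big_ind (ideal_exp I n)) => //;
   [exact: ideal_exp0 | exact: ideal_expD].
Qed.

(** The Rees algebra, realized as the subring of R[X] of the polynomials
    whose n-th coefficient lies in I^n for every n. *)
Definition rees_pred (p : {poly R}) : bool :=
  `[< forall n, ideal_exp I n p`_n >].

Fact rees_subring_closed : subring_closed rees_pred.
Proof.
split=> [|p q|p q].
- by apply/asboolP => -[|n] //; rewrite coef1; exact: ideal_exp0.
- move=> /asboolP pI /asboolP qI; apply/asboolP => n; rewrite coefB.
  exact/ideal_expD/ideal_expN.
- move=> /asboolP pI /asboolP qI; apply/asboolP => n; rewrite coefM.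
  apply: ideal_exp_sum => i _.
  by rewrite -{1}(subnKC (leq_ord i)); apply: ideal_exp_mulr.
Qed.
HB.instance Definition _ :=
  GRing.isSubringClosed.Build {poly R} rees_pred rees_subring_closed.

Record rees := Rees { rees_val : {poly R}; _ : rees_val \in rees_pred }.
HB.instance Definition _ := [isSub for rees_val].
HB.instance Definition _ := [Choice of rees by <:].
HB.instance Definition _ := [SubChoice_isSubNzRing of rees by <:].

Fact rees_comp_subproof n (p : rees) :
  (val p)`_n *: 'X^n \in rees_pred.
Proof.
have /asboolP pI := valP p; apply/asboolP => m; rewrite coefZ coefXn.
by case: eqP => [->|_]; rewrite (mulr1, mulr0); [exact: pI | exact: ideal_exp0].
Qed.
Definition rees_comp n (p : rees) : rees := Rees (rees_comp_subproof n p).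

End Powers.

Section Modules.
Variables (R : nzRingType) (V : lmodType R).

Definition submodule (N : set V) : Prop :=
  [/\ N 0, forall x y, N x -> N y -> N (x + y)
         & forall a x, N x -> N (a *: x)].

Definition lin_span (s : seq V) : set V :=
  [set v | exists c : 'I_(size s) -> R, v = \sum_(i < size s) c i *: s`_i].

Definition finitely_generated (N : set V) : Prop :=
  exists s : seq V, N = lin_span s.

Definition torsion (I : ideal R) : Prop :=
  forall v : V, exists n : nat,
    (0 < n)%N /\ forall a, ideal_exp I n a -> a *: v = 0.

End Modules.

Definition fg_module (R : nzRingType) (V : lmodType R) : Prop :=
  finitely_generated [set: V].

(* Left ideals of a ring S are the submodules of the regular module S^o. *)
Definition graded_left_ideal (R : nzRingType) (I : ideal R)
    (J : set (rees I)^o) : Prop :=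
  submodule J /\ forall n (p : rees I), J p -> J (rees_comp n p).

Definition rees_graded_left_noetherian (R : nzRingType) (I : ideal R) : Prop :=
  forall J : set (rees I)^o, graded_left_ideal J -> finitely_generated J.

Section AugmentationIdeal.
Context {k : fieldType} (L : lieAlgType k).

Let aug_ker : set (UEA L) := [set a | uea_aug L a = 0].

Fact aug_ker0 : aug_ker 0. Proof. exact: raddf0. Qed.
Fact aug_kerD a b : aug_ker a -> aug_ker b -> aug_ker (a + b).
Proof.
move=> a0 b0; apply: etrans (raddfD (uea_aug L) a b) _.
by rewrite [X in X + _]a0 [X in _ + X]b0 addr0.
Qed.
Fact aug_kerMl a b : aug_ker b -> aug_ker (a * b).
Proof.
move=> a0; apply: etrans (rmorphM (uea_aug L) a b) _.
by rewrite [X in _ * X]a0 mulr0.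
Qed.
Fact aug_kerMr a b : aug_ker a -> aug_ker (a * b).
Proof.
move=> a0; apply: etrans (rmorphM (uea_aug L) a b) _.
by rewrite [X in X * _]a0 mul0r.
Qed.

Definition aug_ideal : ideal (UEA L) :=
  Ideal aug_ker0 aug_kerD aug_kerMl aug_kerMr.

End AugmentationIdeal.

(* Hom-types are setoids: [heq] is the equality of parallel morphisms. *)
Record category := Category {
  obj :> Type;
  hom : obj -> obj -> Type;
  heq : forall x y, hom x y -> hom x y -> Prop;
  idm : forall x, hom x x;
  hcomp : forall x y z, hom y z -> hom x y -> hom x z;
  heq_refl : forall x y (f : hom x y), heq f f;
  heq_sym : forall x y (f g : hom x y), heq f g -> heq g f;
  heq_trans : forall x y (f g h : hom x y), heq f g -> heq g h -> heq f h;
  hcomp_heq : forall x y z (f f' : hom y z) (g g' : hom x y),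
    heq f f' -> heq g g' -> heq (hcomp f g) (hcomp f' g');
  hcompA : forall x y z t (f : hom z t) (g : hom y z) (h : hom x y),
    heq (hcomp f (hcomp g h)) (hcomp (hcomp f g) h);
  hcomp_idl : forall x y (f : hom x y), heq (hcomp (idm y) f) f;
  hcomp_idr : forall x y (f : hom x y), heq (hcomp f (idm x)) f
}.
Arguments hom {c}.
Arguments heq {c x y}.
Arguments idm {c}.
Arguments hcomp {c x y z}.

Record functor (C D : category) := Functor {
  fobj :> C -> D;
  fmap : forall x y, hom x y -> hom (fobj x) (fobj y);
  fmap_heq : forall x y (f g : hom x y), heq f g -> heq (fmap f) (fmap g);
  fmap_id : forall x, heq (fmap (idm x)) (idm (fobj x));
  fmap_comp : forall x y z (f : hom y z) (g : hom x y),
    heq (fmap (hcomp f g)) (hcomp (fmap f) (fmap g))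
}.
Arguments fmap {C D} f0 {x y}.

Definition functor_id (C : category) : functor C C.
Proof.
exists id (fun x y f => f) => *; [done | exact: heq_refl | exact: heq_refl].
Defined.

Definition functor_comp (C D E : category) (G : functor D E) (F : functor C D) :
  functor C E.
Proof.
exists (fun x => G (F x)) (fun x y f => fmap G (fmap F f)).
- by move=> x y f g fg; do 2!apply: fmap_heq.
- by move=> x; apply: heq_trans (fmap_id G _); apply: fmap_heq; apply: fmap_id.
- move=> x y z f g; apply: heq_trans (fmap_comp G _ _).
  by apply: fmap_heq; apply: fmap_comp.
Defined.

Definition naturally_isomorphic (C D : category) (F G : functor C D) : Prop :=
  exists (e : forall x, hom (F x) (G x)) (e' : forall x, hom (G x) (F x)),
    [/\ forall x y (f : hom x y),
          heq (hcomp (e y) (fmap F f)) (hcomp (fmap G f) (e x)),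
        forall x, heq (hcomp (e' x) (e x)) (idm (F x))
      & forall x, heq (hcomp (e x) (e' x)) (idm (G x))].

Definition is_equivalence (C D : category) (F : functor C D) : Prop :=
  exists G : functor D C,
    naturally_isomorphic (functor_comp G F) (functor_id C) /\
    naturally_isomorphic (functor_comp F G) (functor_id D).

Section FullSubcategory.
Variables (C : category) (P : C -> Prop).

Definition full_sub : category.
Proof.
refine (@Category {x : C | P x} (fun x y => hom (sval x) (sval y))
  (fun x y f g => heq f g) (fun x => idm (sval x)) (fun x y z f g => hcomp f g)
  _ _ _ _ _ _ _) => *.
- exact: heq_refl.
- exact: heq_sym.
- by apply: heq_trans; eassumption.
- exact: hcomp_heq.
- exact: hcompA.
- exact: hcomp_idl.
- exact: hcomp_idr.
Defined.

Definition full_sub_corestrict (B : category) (F : functor B C)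
  (FP : forall x, P (F x)) : functor B full_sub.
Proof.
exists (fun x => exist P (F x) (FP x) : full_sub)
       (fun x y f => fmap F f) => *.
- exact: fmap_heq.
- exact: fmap_id.
- exact: fmap_comp.
Defined.

End FullSubcategory.

Definition full_sub_mono (C : category) (P Q : C -> Prop)
  (PQ : forall x, P x -> Q x) : functor (full_sub P) (full_sub Q).
Proof.
exists (fun x => exist Q (sval x) (PQ _ (svalP x)) : full_sub Q)
       (fun x y f => f) => *; [done | exact: heq_refl | exact: heq_refl].
Defined.

Definition morphism_class (C : category) := forall x y : C, hom x y -> Prop.

(** The Gabriel-Zisman localization C[W^-1]: the morphisms are the formal
    composites of morphisms of C and of inverses of morphisms in W, modulo
    the relations of C and those making [lhom_inv s] inverse to s. *)
Section Localization.
Variables (C : category) (W : morphism_class C).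

Inductive lhom : C -> C -> Type :=
  | lhom_in x y (f : hom x y) : lhom x y
  | lhom_inv x y (s : hom x y) (sW : W s) : lhom y x
  | lhom_comp x y z (f : lhom y z) (g : lhom x y) : lhom x z.

Inductive lheq : forall x y, lhom x y -> lhom x y -> Prop :=
  | lheq_refl x y (f : lhom x y) : lheq f f
  | lheq_sym x y (f g : lhom x y) : lheq f g -> lheq g f
  | lheq_trans x y (f g h : lhom x y) : lheq f g -> lheq g h -> lheq f h
  | lheq_comp x y z (f f' : lhom y z) (g g' : lhom x y) :
      lheq f f' -> lheq g g' -> lheq (lhom_comp f g) (lhom_comp f' g')
  | lheq_compA x y z t (f : lhom z t) (g : lhom y z) (h : lhom x y) :
      lheq (lhom_comp f (lhom_comp g h)) (lhom_comp (lhom_comp f g) h)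
  | lheq_idl x y (f : lhom x y) : lheq (lhom_comp (lhom_in (idm y)) f) f
  | lheq_idr x y (f : lhom x y) : lheq (lhom_comp f (lhom_in (idm x))) f
  | lheq_in x y (f g : hom x y) : heq f g -> lheq (lhom_in f) (lhom_in g)
  | lheq_in_comp x y z (f : hom y z) (g : hom x y) :
      lheq (lhom_in (hcomp f g)) (lhom_comp (lhom_in f) (lhom_in g))
  | lheq_invl x y (s : hom x y) (sW : W s) :
      lheq (lhom_comp (lhom_inv sW) (lhom_in s)) (lhom_in (idm x))
  | lheq_invr x y (s : hom x y) (sW : W s) :
      lheq (lhom_comp (lhom_in s) (lhom_inv sW)) (lhom_in (idm y)).

Definition localization : category :=
  @Category C lhom lheq (fun x => lhom_in (idm x)) lhom_comp
    lheq_refl lheq_sym lheq_trans lheq_comp lheq_compA lheq_idl lheq_idr.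

End Localization.

Section LocalizationFunctor.
Variables (C D : category) (V : morphism_class C) (W : morphism_class D).
Variables (F : functor C D).
Hypothesis FVW : forall x y (s : hom x y), V s -> W (fmap F s).

Fixpoint lmap x y (f : lhom V x y) : lhom W (F x) (F y) :=
  match f with
  | lhom_in _ _ f => lhom_in W (fmap F f)
  | lhom_inv _ _ s sV => lhom_inv (FVW sV)
  | lhom_comp _ _ _ f g => lhom_comp (lmap f) (lmap g)
  end.

Fact lmap_lheq x y (f g : lhom V x y) : lheq f g -> lheq (lmap f) (lmap g).
Proof.
elim=> {x y f g} /=.
- by move=> *; exact: lheq_refl.
- by move=> *; exact: lheq_sym.
- by move=> x y f g h _ fg _; exact: lheq_trans.
- by move=> *; exact: lheq_comp.
- by move=> *; exact: lheq_compA.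
- move=> x y f; apply: lheq_trans (lheq_idl _).
  exact/lheq_comp/lheq_refl/lheq_in/fmap_id.
- move=> x y f; apply: lheq_trans (lheq_idr _).
  exact/lheq_comp/lheq_in/fmap_id/lheq_refl.
- by move=> *; exact/lheq_in/fmap_heq.
- by move=> *; apply: lheq_trans (lheq_in_comp _ _ _); exact/lheq_in/fmap_comp.
- move=> x y s sV; apply: lheq_trans (lheq_invl _) _.
  exact/lheq_sym/lheq_in/fmap_id.
- move=> x y s sV; apply: lheq_trans (lheq_invr _) _.
  exact/lheq_sym/lheq_in/fmap_id.
Qed.

Definition localization_map : functor (localization V) (localization W).
Proof.
exists (F : localization V -> localization W) lmap.
- exact: lmap_lheq.
- by move=> x; exact/lheq_in/fmap_id.
- by move=> *; exact: lheq_refl.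
Defined.

End LocalizationFunctor.

Section QuotientModule.
Variables (R : nzRingType) (V : lmodType R) (N : set V) (subN : submodule N).

Definition submod_pred (_ : submodule N) (v : V) : bool := `[< N v >].

Fact submod_pred_closed : subsemimod_closed (submod_pred subN).
Proof.
case: (subN) => N0 ND NZ; split; first split.
- exact/asboolP.
- by move=> x y /asboolP Nx /asboolP Ny; apply/asboolP/ND.
- by move=> a x /asboolP Nx; apply/asboolP/NZ.
Qed.
HB.instance Definition _ :=
  GRing.isSubmodClosed.Build R V (submod_pred subN) submod_pred_closed.

Definition quotient_module :=
  Quotient.quot (GRing.ZmodClosed.clone V (submod_pred subN) _).
HB.instance Definition _ := GRing.Zmodule.on quotient_module.

Definition quotient_pi : V -> quotient_module := \pi_quotient_module.

Lemma quotient_piP x y : quotient_pi x = quotient_pi y <-> N (x - y).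
Proof.
split=> [/eqP|Nxy]; first by rewrite -Quotient.idealrBE => /asboolP.
by apply/eqP; rewrite -Quotient.idealrBE; exact/asboolP.
Qed.

Lemma quotient_repr (q : quotient_module) : quotient_pi (repr q) = q.
Proof. exact: reprK. Qed.

Lemma quotient_piD : {morph quotient_pi : x y / x + y}.
Proof. exact: Quotient.pi_add. Qed.

Definition quotient_scale (a : R) (q : quotient_module) : quotient_module :=
  quotient_pi (a *: repr q).

Lemma quotient_piZ a x : quotient_pi (a *: x) = quotient_scale a (quotient_pi x).
Proof.
have [_ _ NZ] := subN; apply/quotient_piP; rewrite -scalerBr; apply: NZ.
by apply/quotient_piP; rewrite quotient_repr.
Qed.

Lemma quotientW (P : quotient_module -> Prop) :
  (forall x, P (quotient_pi x)) -> forall q, P q.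
Proof. by move=> h q; rewrite -(quotient_repr q). Qed.

Fact quotient_scalerA a b q :
  quotient_scale a (quotient_scale b q) = quotient_scale (a * b) q.
Proof. by elim/quotientW: q => x; rewrite -!quotient_piZ scalerA. Qed.
Fact quotient_scale1r : left_id 1 quotient_scale.
Proof. by elim/quotientW => x; rewrite -quotient_piZ scale1r. Qed.
Fact quotient_scalerDr : right_distributive quotient_scale +%R.
Proof.
move=> a; elim/quotientW => x; elim/quotientW => y.
by rewrite -!(quotient_piZ, quotient_piD) scalerDr.
Qed.
Fact quotient_scalerDl q : {morph quotient_scale^~ q : a b / a + b}.
Proof.
move=> a b; elim/quotientW: q => x /=.
by rewrite -!(quotient_piZ, quotient_piD) scalerDl.
Qed.
HB.instance Definition _ := GRing.Zmodule_isLmodule.Build R quotient_module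
  quotient_scalerA quotient_scale1r quotient_scalerDr quotient_scalerDl.

Fact quotient_pi_linear : linear quotient_pi.
Proof. by move=> a x y; rewrite quotient_piD quotient_piZ. Qed.
HB.instance Definition _ := GRing.isLinear.Build R V quotient_module *:%R
  quotient_pi quotient_pi_linear.

End QuotientModule.

Section Kernel.
Variables (R : nzRingType) (V W : lmodType R) (f : {linear V -> W}).

Definition ker_pred (v : V) : bool := f v == 0.

Fact ker_pred_closed : subsemimod_closed ker_pred.
Proof.
split; first split.
- by rewrite unfold_in linear0.
- move=> x y /eqP fx /eqP fy; apply/eqP.
  by rewrite linearD fx fy addr0.
- by move=> a x /eqP fx; apply/eqP; rewrite linearZ /= fx scaler0.
Qed.
HB.instance Definition _ :=
  GRing.isSubmodClosed.Build R V ker_pred ker_pred_closed.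

Record kernel := Kernel { kernel_val : V; _ : kernel_val \in ker_pred }.
HB.instance Definition _ := [isSub for kernel_val].
HB.instance Definition _ := [Choice of kernel by <:].
HB.instance Definition _ := [SubChoice_isSubLmodule of kernel by <:].

Lemma kernelP (z : kernel) : f (val z) = 0.
Proof. exact/eqP/(valP z). Qed.

End Kernel.

Section Complexes.
Variable R : nzRingType.

Record complex := Complex {
  cterm :> int -> lmodType R;
  diff : forall i, {linear cterm i -> cterm (i + 1)};
  diff_diff : forall i x, diff (i + 1) (diff i x) = 0
}.

Definition bounded (X : complex) : Prop :=
  exists a b : int, forall i, (i < a) || (b < i) -> forall x : X i, x = 0.

Section Cohomology.
Variables (X : complex) (i : int).

Definition boundaries : set (kernel (diff X (i + 1))) :=
  [set z | exists y, val z = diff X i y].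

Fact boundaries_submodule : submodule boundaries.
Proof.
split.
- by exists 0; rewrite !linear0.
- by move=> z t [x zx] [y ty]; exists (x + y); rewrite !linearD /= zx ty.
- by move=> a z [x zx]; exists (a *: x); rewrite !linearZ /= zx.
Qed.

(* The cohomology module in degree i + 1; indexing it by i avoids transports
   along i - 1 + 1 = i, and i + 1 runs over all integers. *)
Definition cohomology := quotient_module boundaries_submodule.
HB.instance Definition _ := GRing.Lmodule.on cohomology.

End Cohomology.

Record chain_map (X Y : complex) := ChainMap {
  cmap :> forall i, {linear X i -> Y i};
  cmap_diff : forall i x, cmap (i + 1) (diff X i x) = diff Y i (cmap i x)
}.

Section CohomologyMap.
Variables (X Y : complex) (f : chain_map X Y) (i : int).

Fact cocycle_map_subproof (z : kernel (diff X (i + 1))) :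
  f (i + 1) (val z) \in ker_pred (diff Y (i + 1)).
Proof. by rewrite unfold_in -cmap_diff kernelP linear0. Qed.

Definition cocycle_map (z : kernel (diff X (i + 1))) :
  kernel (diff Y (i + 1)) := Kernel (cocycle_map_subproof z).

Definition cohomology_map (c : cohomology X i) : cohomology Y i :=
  quotient_pi (boundaries_submodule Y i) (cocycle_map (repr c)).

Lemma cohomology_map_pi z :
  cohomology_map (quotient_pi (boundaries_submodule X i) z) =
  quotient_pi (boundaries_submodule Y i) (cocycle_map z).
Proof.
apply/quotient_piP; set t := repr _.
have /quotient_piP[y ty] : quotient_pi (boundaries_submodule X i) t =
  quotient_pi (boundaries_submodule X i) z by exact: quotient_repr.
by exists (f i y); rewrite linearB /= -linearB -cmap_diff -ty linearB.
Qed.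

End CohomologyMap.

Definition quasi_isomorphism (X Y : complex) (f : chain_map X Y) : Prop :=
  forall i, bijective (@cohomology_map X Y f i).

Definition homotopic (X Y : complex) (f g : chain_map X Y) : Prop :=
  exists h : forall i, {linear X (i + 1) -> Y i},
    forall i x, f (i + 1) x - g (i + 1) x =
      diff Y i (h i x) + h (i + 1) (diff X (i + 1) x).

Definition chain_id (X : complex) : chain_map X X :=
  @ChainMap X X (fun i => idfun) (fun i x => erefl).

Definition chain_comp (X Y Z : complex) (f : chain_map Y Z) (g : chain_map X Y) :
  chain_map X Z.
Proof.
exists (fun i => f i \o g i) => i x /=.
by rewrite !cmap_diff.
Defined.

Lemma homotopic_eq (X Y : complex) (f g : chain_map X Y) :
  (forall i x, f i x = g i x) -> homotopic f g.
Proof.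
by move=> fg; exists (fun i => \0) => i x; rewrite fg subrr /= linear0 addr0.
Qed.

Lemma homotopic_sym (X Y : complex) (f g : chain_map X Y) :
  homotopic f g -> homotopic g f.
Proof.
move=> [h fg]; exists (fun i => \- h i) => i x /=.
by rewrite linearN -opprD -fg opprB.
Qed.

Lemma homotopic_trans (X Y : complex) (f g h : chain_map X Y) :
  homotopic f g -> homotopic g h -> homotopic f h.
Proof.
move=> [s fg] [t gh]; exists (fun i => s i \+ t i) => i x /=.
by rewrite linearD addrACA -fg -gh addrA subrK.
Qed.

Lemma homotopic_comp (X Y Z : complex) (f f' : chain_map Y Z)
    (g g' : chain_map X Y) :
  homotopic f f' -> homotopic g g' ->
  homotopic (chain_comp f g) (chain_comp f' g').
Proof.
move=> [s ff'] [t gg'].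
exists (fun i => (s i \o g (i + 1)) \+ (f' i \o t i)) => i x /=.
have fs := ff' i (g (i + 1) x); have gt := congr1 (f' (i + 1)) (gg' i x).
rewrite linearB linearD cmap_diff in gt.
rewrite -(subrKA (f' (i + 1) (g (i + 1) x))) fs gt linearD cmap_diff.
by rewrite addrACA.
Qed.

Definition homotopy_category : category.
Proof.
refine (@Category complex chain_map homotopic chain_id chain_comp
  _ homotopic_sym homotopic_trans homotopic_comp _ _ _).
- by move=> X Y f; exact: homotopic_eq.
- by move=> *; exact: homotopic_eq.
- by move=> *; exact: homotopic_eq.
- by move=> *; exact: homotopic_eq.
Defined.

(** [Kb P] and [Db P] are K^b(A) and D^b(A) for the full subcategory A of the
    R-modules satisfying P.  Cohomology is that of R-modules, which is the one
    of A when A is closed under kernels and cokernels; this holds for finitely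
    generated modules over a left Noetherian ring such as U(L), and for the
    I-torsion ones among them. *)
Section DerivedCategory.
Variable P : lmodType R -> Prop.

Definition Kb_objects (X : complex) : Prop :=
  bounded X /\ forall i, P (X i).

Definition Kb : category :=
  @full_sub homotopy_category Kb_objects.

Definition Kb_quasi_isomorphism : morphism_class Kb :=
  fun X Y f => quasi_isomorphism f.

Definition Db : category := localization Kb_quasi_isomorphism.

End DerivedCategory.

Section DerivedInclusion.
Variables (P Q : lmodType R -> Prop) (PQ : forall V, P V -> Q V).

Fact Kb_objects_mono X : Kb_objects P X -> Kb_objects Q X.
Proof. by case=> bX PX; split=> // i; apply: PQ. Qed.

Definition Kb_inclusion : functor (Kb P) (Kb Q) :=
  @full_sub_mono homotopy_category _ _ Kb_objects_mono.

Definition Db_inclusion : functor (Db P) (Db Q) :=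
  @localization_map _ _ _ _ Kb_inclusion
    (fun X Y s (sW : Kb_quasi_isomorphism s) => sW).

End DerivedInclusion.

Section Phi.
Variable I : ideal R.

Definition fg_torsion_module (V : lmodType R) : Prop :=
  fg_module V /\ torsion V I.

Definition Db_torsion : category :=
  @full_sub (Db (@fg_module R))
    (fun X => forall i, torsion (cohomology (sval X) i) I).

Lemma torsion_cohomology (X : complex) :
  (forall i, torsion (X i) I) -> forall i, torsion (cohomology X i) I.
Proof.
move=> tX i; elim/quotientW => z; have [n [n0 zn]] := tX _ (val z).
exists n; split=> // a /zn az0.
by rewrite -linearZ /=; have -> : a *: z = 0; [exact: val_inj|exact: linear0].
Qed.

Fact Phi_subproof (X : Db fg_torsion_module) :
  forall i, torsion
    (cohomology (sval (Db_inclusion (fun V => @proj1 _ _) X)) i) I.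
Proof.
by apply: torsion_cohomology => i; case: (svalP X) => _ /(_ i)[].
Qed.

Definition Phi : functor (Db fg_torsion_module) Db_torsion :=
  full_sub_corestrict Phi_subproof.

End Phi.
End Complexes.

(* Main.v *)
From HB Require Import structures.
From mathcomp Require Import all_boot all_order all_algebra.
From mathcomp Require Import boolp classical_sets zify.
Require Import Defs.

(** The theorem is the case R = U(L) of [Phi_equivalence], about a ring R and a
    two-sided ideal I whose Rees algebra is graded left Noetherian.

    Artin-Rees.  Let M be generated by a finite list.  A sequence of submodules
    N_n of I^n M with I^m N_n in N_(m+n) is finitely generated as a graded
    object: peel off one generator y of M at a time, the coefficients of y in
    the elements of N_n form a graded left ideal of the Rees algebra
    ([graded_submodule_finitely_generated]).  For a submodule Z of M and
    N_n = Z meet I^n M, a bound c on the degrees of the generators gives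
    Z meet I^(n+c) M inside I^n Z ([artin_rees]), and degree 0 says that Z is
    finitely generated.

    Torsion quotients.  Let X be a bounded complex of finitely generated modules
    with torsion cohomology.  Some power of I maps the cocycles of degree i + 1
    into the coboundaries, so that with Artin-Rees there is a shift e for which
    every cocycle in I^(n+e) X^(i+1) is the boundary of an element of I^n X^i
    ([adic_exactness]).  If the exponents n_i grow fast enough with i, the
    subcomplex with terms I^(n_i) X^i + d (I^(n_(i-1)) X^(i-1)) is then acyclic,
    and the quotient of X by it is a quasi-isomorphic complex of torsion modules
    ([torsion_quotient]).  This gives essential surjectivity.

    Full faithfulness.  Let Y be a complex of torsion modules.  The homotopy
    pushout of a quasi-isomorphism X -> X' along X -> Y is quasi-isomorphic to
    Y, hence has torsion cohomology, and by the previous step it maps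
    quasi-isomorphically to a complex of torsion modules; likewise for a homotopy
    coequalizer.  So quasi-isomorphisms out of an arbitrary X can be inverted
    and cancelled using only targets among the torsion complexes
    ([torsion_square], [torsion_coequalizer]).  For fixed Y, let H(X) be the set
    of roofs X -> Z <- Y, with Z torsion and Y -> Z a quasi-isomorphism, modulo
    the obvious equivalence.  Precomposition makes H a functor on which
    quasi-isomorphisms act bijectively, so all formal words of the localization
    act on H ([act]), and acting on the identity roof of Y recovers the word
    ([fraction_act_id]).  For X torsion the resulting description of the
    morphisms X -> Y is literally the same in both derived categories. *)

Set Implicit Arguments.
Unset Strict Implicit.
Unset Printing Implicit Defensive.

Import GRing.Theory Num.Theory Order.TTheory.
Local Open Scope ring_scope.
Local Open Scope classical_set_scope.

(** * Equivalences of categories *)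

Section FullyFaithful.
Variables (C D : category) (F : functor C D).

Definition full : Prop :=
  forall x y (g : hom (F x) (F y)), exists f, heq (fmap F f) g.

Definition faithful : Prop :=
  forall x y (f g : hom x y), heq (fmap F f) (fmap F g) -> heq f g.

Definition essentially_surjective : Prop :=
  forall d, exists c (e : hom (F c) d) (e' : hom d (F c)),
    heq (hcomp e e') (idm d) /\ heq (hcomp e' e) (idm (F c)).

Lemma fully_faithful_equivalence :
  full -> faithful -> essentially_surjective -> is_equivalence F.
Proof.
move=> Ffull Ffaith Fess.
have data d : {c & {e : hom (F c) d & {e' : hom d (F c) |
    heq (hcomp e e') (idm d) /\ heq (hcomp e' e) (idm (F c))}}}.
  by case: (cid (Fess d)) => c /cid[e /cid[e' inv_e]]; exists c, e, e'.
pose G d := projT1 (data d).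
pose e d : hom (F (G d)) d := projT1 (projT2 (data d)).
pose e' d : hom d (F (G d)) := sval (projT2 (projT2 (data d))).
have ee' d : heq (hcomp (e d) (e' d)) (idm d).
  by have [] := svalP (projT2 (projT2 (data d))).
have e'e d : heq (hcomp (e' d) (e d)) (idm (F (G d))).
  by have [] := svalP (projT2 (projT2 (data d))).
pose lift x y (g : hom (F x) (F y)) := projT1 (cid (Ffull x y g)).
have liftE x y (g : hom (F x) (F y)) : heq (fmap F (lift x y g)) g.
  exact: projT2 (cid (Ffull x y g)).
pose Gm x y (f : hom x y) : hom (G x) (G y) :=
  lift _ _ (hcomp (e' y) (hcomp f (e x))).
have GmE x y (f : hom x y) :
    heq (fmap F (Gm x y f)) (hcomp (e' y) (hcomp f (e x))).
  exact: liftE.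
have e'K x y (f : hom x y) : heq (hcomp (e y) (hcomp (e' y) f)) f.
  apply: heq_trans (hcompA _ _ _) _; apply: heq_trans (hcomp_idl _).
  exact: hcomp_heq (ee' y) (heq_refl _).
have G_heq x y (f g : hom x y) : heq f g -> heq (Gm x y f) (Gm x y g).
  move=> fg; apply: Ffaith; apply: heq_trans (GmE _ _ _) _.
  apply: heq_sym; apply: heq_trans (GmE _ _ _) _; apply: heq_sym.
  exact: hcomp_heq (heq_refl _) (hcomp_heq fg (heq_refl _)).
have G_id x : heq (Gm x x (idm x)) (idm (G x)).
  apply: Ffaith; apply: heq_trans (GmE _ _ _) _.
  apply: heq_trans (heq_sym (fmap_id F _)).
  apply: heq_trans (e'e x); exact: hcomp_heq (heq_refl _) (hcomp_idl _).
have G_comp x y z (f : hom y z) (g : hom x y) :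
    heq (Gm x z (hcomp f g)) (hcomp (Gm y z f) (Gm x y g)).
  apply: Ffaith; apply: heq_trans (GmE _ _ _) _.
  apply: heq_sym; apply: heq_trans (fmap_comp F _ _) _.
  apply: heq_trans (hcomp_heq (GmE _ _ _) (GmE _ _ _)) _.
  apply: heq_trans (heq_sym (hcompA _ _ _)) _.
  apply: hcomp_heq (heq_refl _) _.
  apply: heq_trans (heq_sym (hcompA _ _ _)) _.
  apply: heq_trans (hcompA _ _ _).
  exact: hcomp_heq (heq_refl _) (e'K _ _ _).
exists (@Functor D C G Gm G_heq G_id G_comp); split.
- exists (fun c => lift _ _ (e (F c))), (fun c => lift _ _ (e' (F c))).
  split=> [x y f|x|x] /=; apply: Ffaith.
  + apply: heq_trans (fmap_comp F _ _) _.
    apply: heq_trans (hcomp_heq (liftE _ _ _) (GmE _ _ _)) _.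
    apply: heq_trans (e'K _ _ _) _; apply: heq_sym.
    apply: heq_trans (fmap_comp F _ _) _.
    exact: hcomp_heq (heq_refl _) (liftE _ _ _).
  + apply: heq_trans (fmap_comp F _ _) _.
    apply: heq_trans (hcomp_heq (liftE _ _ _) (liftE _ _ _)) _.
    exact: heq_trans (e'e _) (heq_sym (fmap_id F _)).
  + apply: heq_trans (fmap_comp F _ _) _.
    apply: heq_trans (hcomp_heq (liftE _ _ _) (liftE _ _ _)) _.
    exact: heq_trans (ee' _) (heq_sym (fmap_id F _)).
- exists e, e'; split=> // x y f /=.
  apply: heq_trans (hcomp_heq (heq_refl _) (GmE _ _ _)) _.
  exact: e'K.
Qed.

End FullyFaithful.

(** * Left fractions with apex in a smaller full subcategory *)

(** Expanding a fraction e^-1 m by a morphism v does not change it, even if v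
    itself is not inverted. *)
Lemma lfraction_expand (C : category) (V : morphism_class C) (x y b z : C)
    (m : hom x b) (e : hom y b) (n : hom x z) (w : hom y z) (v : hom b z)
    (Ve : V _ _ e) (Vw : V _ _ w) :
  heq n (hcomp v m) -> heq w (hcomp v e) ->
  lheq (lhom_comp (lhom_inv Ve) (lhom_in V m))
       (lhom_comp (lhom_inv Vw) (lhom_in V n)).
Proof.
move=> nm we; apply: lheq_sym.
apply: lheq_trans (lheq_comp (lheq_refl _) (lheq_in V nm)) _.
apply: lheq_trans (lheq_comp (lheq_refl _) (lheq_in_comp _ _ _)) _.
apply: lheq_trans (lheq_compA _ _ _) _; apply: lheq_comp (lheq_refl _).
apply: lheq_trans (lheq_sym (lheq_idr _)) _.
apply: lheq_trans (lheq_comp (lheq_refl _) (lheq_sym (lheq_invr Ve))) _.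
apply: lheq_trans (lheq_compA _ _ _) _.
apply: lheq_trans (lheq_idl _); apply: lheq_comp (lheq_refl _).
apply: lheq_trans (lheq_invl Vw).
apply: lheq_trans (lheq_sym (lheq_compA _ _ _)) _.
apply: lheq_comp (lheq_refl _) _.
by apply: lheq_trans (lheq_sym (lheq_in_comp _ _ _)) _; apply/lheq_in/heq_sym.
Qed.

Section Fractions.
Variables (K : category) (W : morphism_class K).

Definition restrict (N : K -> Prop) : morphism_class (full_sub N) :=
  fun x y f => W f.

(** The larger subcategory is cut out by [P], the smaller one by [Q].  In
    [W_square] and [W_coequalize] the source objects are only in [P] while the
    new object is again in [Q]: this mixed form of the Ore conditions lets words
    that wander through [P] act on roofs that stay in [Q]. *)
Variables (P Q : K -> Prop).
Hypothesis QP : forall x, Q x -> P x.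

Hypothesis W_id : forall x, W (idm x).
Hypothesis W_comp : forall x y z (f : hom y z) (g : hom x y),
  W f -> W g -> W (hcomp f g).
Hypothesis W_heq : forall x y (f g : hom x y), heq f g -> W f -> W g.
Hypothesis W_cancel : forall x y z (f : hom y z) (g : hom x y),
  W g -> W (hcomp f g) -> W f.
Hypothesis W_square : forall x x' y (s : hom x x') (g : hom x y),
  P x -> P x' -> Q y -> W s ->
  exists y' (k : hom x' y') (u : hom y y'),
    [/\ Q y', W u & heq (hcomp k s) (hcomp u g)].
Hypothesis W_coequalize : forall x x' y (s : hom x x') (f g : hom x' y),
  P x -> P x' -> Q y -> W s -> heq (hcomp f s) (hcomp g s) ->
  exists y' (u : hom y y'), [/\ Q y', W u & heq (hcomp u f) (hcomp u g)].

Record roof (x y : K) := Roof {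
  apex : K;
  roof_num : hom x apex;
  roof_den : hom y apex;
  apexQ : Q apex;
  roof_denW : W roof_den
}.

Definition req x y (r r' : roof x y) : Prop :=
  exists z (u : hom (apex r) z) (u' : hom (apex r') z),
    [/\ Q z, W u, W u',
        heq (hcomp u (roof_num r)) (hcomp u' (roof_num r'))
      & heq (hcomp u (roof_den r)) (hcomp u' (roof_den r'))].

Lemma req_refl x y (r : roof x y) : req r r.
Proof.
exists (apex r), (idm _), (idm _).
by split; [exact: apexQ|exact: W_id|exact: W_id|exact: heq_refl|exact: heq_refl].
Qed.

Lemma req_sym x y (r r' : roof x y) : req r r' -> req r' r.
Proof.
by move=> [z [u [u' [Qz Wu Wu' n d]]]]; exists z, u', u; split=> //; apply: heq_sym.
Qed.

(** The two middle denominators are merged by an Ore square; its second leg is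
    inverted as well by the two-out-of-three property. *)
Lemma req_trans x y (r1 r2 r3 : roof x y) : req r1 r2 -> req r2 r3 -> req r1 r3.
Proof.
move=> [z [u1 [u2 [Qz Wu1 Wu2 nu du]]]] [t [v2 [v3 [Qt Wv2 Wv3 nv dv]]]].
have [w [k [l [Qw Wl kl]]]] := W_square v2 (QP (apexQ r2)) (QP Qz) Qt Wu2.
have Wk : W k by apply: W_cancel Wu2 _; apply: W_heq (heq_sym kl) _; exact: W_comp.
have glue a (f1 : hom a (apex r1)) f2 f3 :
    heq (hcomp u1 f1) (hcomp u2 f2) -> heq (hcomp v2 f2) (hcomp v3 f3) ->
    heq (hcomp (hcomp k u1) f1) (hcomp (hcomp l v3) f3).
  move=> uf vf; apply: heq_trans (heq_sym (hcompA _ _ _)) _.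
  apply: heq_trans (hcomp_heq (heq_refl _) uf) _.
  apply: heq_trans (hcompA _ _ _) _.
  apply: heq_trans (hcomp_heq kl (heq_refl _)) _.
  apply: heq_trans (heq_sym (hcompA _ _ _)) _.
  apply: heq_trans (hcomp_heq (heq_refl _) vf) _.
  exact: hcompA.
exists w, (hcomp k u1), (hcomp l v3).
split; [by [] | exact: W_comp | exact: W_comp | |].
- exact: glue nu nv.
- exact: glue du dv.
Qed.

Definition pull x x' y (f : hom x x') (r : roof x' y) : roof x y :=
  Roof (hcomp (roof_num r) f) (apexQ r) (roof_denW r).

Lemma pull_req x x' y (f g : hom x x') (r r' : roof x' y) :
  heq f g -> req r r' -> req (pull f r) (pull g r').
Proof.
move=> fg [z [u [u' [Qz Wu Wu' n d]]]]; exists z, u, u'; split=> //=.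
apply: heq_trans (hcompA _ _ _) _; apply: heq_trans (heq_sym (hcompA _ _ _)).
exact: hcomp_heq n fg.
Qed.

Lemma pull_id x y (r : roof x y) : req (pull (idm x) r) r.
Proof.
exists (apex r), (idm _), (idm _).
by split; [exact: apexQ|exact: W_id|exact: W_id|
  exact: hcomp_heq (heq_refl _) (hcomp_idr _)|exact: heq_refl].
Qed.

Lemma pull_comp x x' x'' y (f : hom x' x'') (g : hom x x') (r : roof x'' y) :
  req (pull (hcomp f g) r) (pull g (pull f r)).
Proof.
exists (apex r), (idm _), (idm _).
by split; [exact: apexQ|exact: W_id|exact: W_id|
  exact: hcomp_heq (heq_refl _) (hcompA _ _ _)|exact: heq_refl].
Qed.

Lemma pull_inj x x' y (s : hom x x') (r r' : roof x' y) :
  P x -> P x' -> W s -> req (pull s r) (pull s r') -> req r r'.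
Proof.
move=> Px Px' Ws [z [u [u' [Qz Wu Wu' /= n d]]]].
have n' : heq (hcomp (hcomp u (roof_num r)) s)
              (hcomp (hcomp u' (roof_num r')) s).
  apply: heq_trans (heq_sym (hcompA _ _ _)) _.
  by apply: heq_trans (hcompA _ _ _).
have [t [v [Qt Wv vn]]] := W_coequalize Px Px' Qz Ws n'.
exists t, (hcomp v u), (hcomp v u').
split; [by [] | exact: W_comp | exact: W_comp | |].
- apply: heq_trans (heq_sym (hcompA _ _ _)) _.
  exact: heq_trans vn (hcompA _ _ _).
- apply: heq_trans (heq_sym (hcompA _ _ _)) _.
  exact: heq_trans (hcomp_heq (heq_refl _) d) (hcompA _ _ _).
Qed.

Lemma pull_surj x x' y (s : hom x x') (r : roof x y) :
  P x -> P x' -> W s -> exists r', req (pull s r') r.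
Proof.
move=> Px Px' Ws.
have [z [k [u [Qz Wu ku]]]] := W_square (roof_num r) Px Px' (apexQ r) Ws.
exists (Roof k Qz (W_comp Wu (roof_denW r))), z, (idm _), u; split=> //=.
- exact: heq_trans (hcomp_idl _) ku.
- exact: hcomp_idl.
Qed.

(** [N] will be [P] and [Q] in turn. *)
Section Action.
Variable N : K -> Prop.
Hypothesis NP : forall x, N x -> P x.

Definition push (x x' : full_sub N) y (s : hom x x') (Ws : restrict s)
    (r : roof (sval x) y) : roof (sval x') y :=
  projT1 (cid (pull_surj r (NP (svalP x)) (NP (svalP x')) Ws)).

Lemma pushK (x x' : full_sub N) y (s : hom x x') (Ws : restrict s)
  (r : roof (sval x) y) : req (pull s (push Ws r)) r.
Proof. by rewrite /push; case: cid. Qed.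

(** The action of words is contravariant, and well defined on roofs only up to
    [req], since [push] involves a choice. *)
Fixpoint act y (x x' : full_sub N) (f : lhom (@restrict N) x x') :
    roof (sval x') y -> roof (sval x) y :=
  match f in lhom _ a b return roof (sval b) y -> roof (sval a) y with
  | lhom_in _ _ f => pull f
  | lhom_inv _ _ s Ws => push Ws
  | lhom_comp _ _ _ f g => fun r => act g (act f r)
  end.

Lemma act_req y (x x' : full_sub N) (f : lhom (@restrict N) x x')
  (r r' : roof (sval x') y) : req r r' -> req (act f r) (act f r').
Proof.
elim: f r r' => {x x'} [x x' f|x x' s Ws|x x' x'' f IHf g IHg] r r' rr' /=.
- exact: pull_req (heq_refl _) rr'.
- apply: (pull_inj (NP (svalP x)) (NP (svalP x')) Ws).
  apply: req_trans (pushK _ _) _; apply: req_trans rr' _.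
  exact/req_sym/pushK.
- exact/IHg/IHf.
Qed.

Lemma act_lheq y (x x' : full_sub N) (f g : lhom (@restrict N) x x')
  (r : roof (sval x') y) : lheq f g -> req (act f r) (act g r).
Proof.
move=> fg; elim: fg r => {x x' f g} /=.
- by move=> x x' f r; exact: req_refl.
- by move=> x x' f g _ IH r; exact: req_sym.
- by move=> x x' f g h _ IH1 _ IH2 r; exact: req_trans (IH1 r) (IH2 r).
- move=> x x' x'' f f' g g' _ IHf _ IHg r.
  exact: req_trans (IHg _) (act_req _ (IHf r)).
- by move=> *; exact: req_refl.
- by move=> x x' f r; apply: act_req; exact: pull_id.
- by move=> x x' f r; exact: pull_id.
- by move=> x x' f g fg r; exact: pull_req fg (req_refl _).
- by move=> x x' x'' f g r; exact: pull_comp.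
- by move=> x x' s Ws r; apply: req_trans (pushK _ _) (req_sym (pull_id _)).
- move=> x x' s Ws r; apply: req_trans _ (req_sym (pull_id _)).
  by apply: (pull_inj (NP (svalP x)) (NP (svalP x')) Ws); exact: pushK.
Qed.

Hypothesis QN : forall x, Q x -> N x.

Definition fraction (x y : full_sub N) (r : roof (sval x) (sval y)) :
    lhom (@restrict N) x y :=
  let z : full_sub N := exist N (apex r) (QN (apexQ r)) in
  lhom_comp (@lhom_inv _ (@restrict N) y z (roof_den r) (roof_denW r))
            (@lhom_in _ (@restrict N) x z (roof_num r)).

Lemma fraction_pull (x x' y : full_sub N) (f : hom x x')
    (r : roof (sval x') (sval y)) :
  lheq (fraction (pull f r : roof (sval x) (sval y)))
       (lhom_comp (fraction r) (lhom_in _ f)).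
Proof.
apply: lheq_trans (lheq_compA _ _ _).
exact: lheq_comp (lheq_refl _) (lheq_in_comp _ _ _).
Qed.

Lemma fraction_req (x y : full_sub N) (r r' : roof (sval x) (sval y)) :
  req r r' -> lheq (fraction r) (fraction r').
Proof.
case: r r' => a n d Qa Wd [a' n' d' Qa' Wd'].
move=> [z [u [u' [/= Qz Wu Wu' nn dd]]]].
suff expand (b : K) (Qb : Q b) (m : hom (sval x) b) (e : hom (sval y) b)
    (We : W e) (v : hom b z) (Wv : W v) :
    heq (hcomp u n) (hcomp v m) -> heq (hcomp u d) (hcomp v e) ->
    lheq (fraction (Roof m Qb We : roof (sval x) (sval y)))
         (fraction (Roof (hcomp u n) Qz (W_comp Wu Wd) : roof (sval x) (sval y))).
  apply: lheq_trans (expand _ Qa n d Wd u Wu (heq_refl _) (heq_refl _)) _.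
  exact/lheq_sym/(expand _ Qa' n' d' Wd' u' Wu').
move=> nm de; exact: (@lfraction_expand (full_sub N) _ x y
  (exist N b (QN Qb)) (exist N z (QN Qz)) m e (hcomp u n) (hcomp u d) v We _ nm de).
Qed.

(** Induction on the word; an inverse s^-1 is handled by inserting s s^-1 on the
    right and using that s acts by precomposition. *)
Lemma fraction_act (x x' y : full_sub N) (f : lhom (@restrict N) x x')
    (r : roof (sval x') (sval y)) :
  lheq (fraction (act f r : roof (sval x) (sval y))) (lhom_comp (fraction r) f).
Proof.
elim: f r => {x x'} [x x' f|x x' s Ws|x x' x'' f IHf g IHg] r /=.
- exact: fraction_pull.
- apply: lheq_trans (lheq_sym (lheq_idr _)) _.
  apply: lheq_trans (lheq_comp (lheq_refl _) (lheq_sym (lheq_invr Ws))) _.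
  apply: lheq_trans (lheq_compA _ _ _) _; apply: lheq_comp (lheq_refl _).
  apply: lheq_trans (lheq_sym (fraction_pull _ _)) _.
  exact/fraction_req/pushK.
- apply: lheq_trans (IHg _) _; apply: lheq_trans (lheq_sym (lheq_compA _ _ _)).
  exact: lheq_comp (IHf _) (lheq_refl _).
Qed.

Definition roof_id y (Qy : Q y) : roof y y :=
  @Roof y y y (idm y) (idm y) Qy (W_id y).

Lemma fraction_act_id (x y : full_sub N) (Qy : Q (sval y))
    (f : lhom (@restrict N) x y) :
  lheq (fraction (act f (roof_id Qy) : roof (sval x) (sval y))) f.
Proof.
(* The apex of the fraction carries another proof of membership than [y]. *)
case: y Qy f => y0 Ny /= Qy f; have Ny_eq := Prop_irrelevance Ny (QN Qy).
subst Ny; apply: lheq_trans (fraction_act _ _) _.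
apply: lheq_trans (lheq_idl _); apply: lheq_comp (lheq_refl _).
pose y : full_sub N := exist N y0 (QN Qy).
exact: (@lheq_invl _ (@restrict N) y y (idm y0) (W_id y0)).
Qed.

End Action.

Definition localization_inclusion :
    functor (localization (@restrict Q)) (localization (@restrict P)) :=
  @localization_map _ _ (@restrict Q) (@restrict P) (full_sub_mono QP)
    (fun x y s Ws => Ws).

Let QQ (x : K) (Qx : Q x) : Q x := Qx.
Let PP (x : K) (Px : P x) : P x := Px.

(** The choices made by [push] in the two subcategories are unrelated, so the
    two actions agree only up to [req]. *)
Lemma act_inclusion (x x' : full_sub Q) y (f : lhom (@restrict Q) x x')
    (r : roof (sval x') y) :
  req (act QP f r)
      (act PP (fmap localization_inclusion f : lhom (@restrict P) _ _) r).
Proof.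
elim: f r => {x x'} [x x' f|x x' s Ws|x x' x'' f IHf g IHg] r /=.
- exact: req_refl.
- apply: (pull_inj (QP (svalP x)) (QP (svalP x')) Ws).
  apply: req_trans (pushK _ _ _) (req_sym _).
  exact: (@pushK P PP (full_sub_mono QP x) (full_sub_mono QP x') y s Ws r).
- apply: req_trans (IHg _) _.
  exact: (@act_req P PP y _ _ (fmap localization_inclusion g : lhom _ _ _)
    _ _ (IHf r)).
Qed.

Lemma localization_inclusion_full : full localization_inclusion.
Proof.
move=> x y f; pose r := act PP (f : lhom (@restrict P) _ _) (roof_id (svalP y)).
exists (@fraction Q QQ x y r).
apply: lheq_trans
  (@fraction_act_id P PP QP (full_sub_mono QP x) (full_sub_mono QP y) (svalP y) f).
(* [z'] and the image of [z] differ by a proof: expand along the identity. *)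
pose z : full_sub Q := exist Q (apex r) (apexQ r).
pose z' : full_sub P := exist P (apex r) (QP (apexQ r)).
exact: (@lfraction_expand (full_sub P) (@restrict P)
  (full_sub_mono QP x) (full_sub_mono QP y) (full_sub_mono QP z) z'
  (roof_num r) (roof_den r) (roof_num r) (roof_den r) (idm (apex r))
  (roof_denW r) (roof_denW r) (heq_sym (hcomp_idl _)) (heq_sym (hcomp_idl _))).
Qed.

Lemma localization_inclusion_faithful : faithful localization_inclusion.
Proof.
move=> x y f g fg.
apply: lheq_trans (lheq_sym (@fraction_act_id Q QP QQ x y (svalP y) f)) _.
apply: lheq_trans (@fraction_act_id Q QP QQ x y (svalP y) g).
apply: fraction_req; apply: req_trans (act_inclusion _ _) _.
apply: req_trans (req_sym (act_inclusion _ _)).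
exact: act_lheq.
Qed.

End Fractions.

(** * Quasi-isomorphisms *)

Definition lin_of (R : nzRingType) (V W : lmodType R) (f : V -> W)
    (f_lin : linear f) : {linear V -> W} :=
  HB.pack f (GRing.isLinear.Build R V W *:%R f f_lin).

Section QuasiIsomorphisms.
Variable R : nzRingType.
Implicit Types X Y Z : complex R.

Definition acyclic X : Prop :=
  forall i (x : X (i + 1)), diff X (i + 1) x = 0 -> exists y, x = diff X i y.

(** The elementwise form used in diagram chases, free of quotients. *)
Lemma quasi_isomorphismP X Y (f : chain_map X Y) :
  quasi_isomorphism f <->
  (forall i (x : X (i + 1)), diff X (i + 1) x = 0 ->
     (exists y, f (i + 1) x = diff Y i y) -> exists z, x = diff X i z) /\
  (forall i (y : Y (i + 1)), diff Y (i + 1) y = 0 ->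
     exists x z, diff X (i + 1) x = 0 /\ y = f (i + 1) x + diff Y i z).
Proof.
split=> [qf|[finj fsurj] i].
  split=> i x dx0.
    move=> [y fxy]; have x_ker : x \in ker_pred (diff X (i + 1)) by apply/eqP.
    pose c := Kernel x_ker; have finj := bij_inj (qf i).
    have /finj/quotient_piP[z] :
        cohomology_map f (quotient_pi (boundaries_submodule X i) c) =
        cohomology_map f (quotient_pi (boundaries_submodule X i) 0).
      rewrite !cohomology_map_pi; apply/quotient_piP.
      by exists y; rewrite linearB /= linear0 subr0.
    by rewrite subr0 /= => xz; exists z.
  have x_ker : x \in ker_pred (diff Y (i + 1)) by apply/eqP.
  pose c := quotient_pi (boundaries_submodule Y i) (Kernel x_ker).
  have [g _ fg] := qf i; have := fg c.
  elim/quotientW: (g c) => t; rewrite cohomology_map_pi => /esym/quotient_piP[z].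
  rewrite linearB /= => zE; exists (val t), z; split; first exact: kernelP.
  by rewrite -zE subrKC.
have inj : injective (@cohomology_map R X Y f i).
  elim/quotientW=> c; elim/quotientW=> c'; rewrite !cohomology_map_pi.
  move=> /quotient_piP[y yE]; apply/quotient_piP.
  apply: (finj i (val (c - c'))); first exact: kernelP.
  by exists y; rewrite -yE !linearB.
have surj (c : cohomology Y i) :
    exists c' : cohomology X i, cohomology_map f c' = c.
  elim/quotientW: c => c.
  have [x [z [dx0 cE]]] := fsurj i (val c) (kernelP c).
  have x_ker : x \in ker_pred (diff X (i + 1)) by apply/eqP.
  exists (quotient_pi (boundaries_submodule X i) (Kernel x_ker)).
  rewrite cohomology_map_pi; apply/quotient_piP; exists (- z).
  by rewrite linearB linearN /= cE opprD addrA subrr add0r.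
exists (fun c => sval (cid (surj c))) => c; last exact: svalP (cid (surj c)).
by apply: inj; exact: svalP (cid (surj _)).
Qed.

Lemma cohomology_map_comp X Y Z (f : chain_map Y Z) (g : chain_map X Y) i c :
  cohomology_map (chain_comp f g) c = cohomology_map f (cohomology_map g c)
    :> cohomology Z i.
Proof.
elim/quotientW: c => c; rewrite !cohomology_map_pi.
by congr quotient_pi; apply: val_inj.
Qed.

Lemma cohomology_map_homotopic X Y (f g : chain_map X Y) i c :
  homotopic f g -> cohomology_map f c = cohomology_map g c :> cohomology Y i.
Proof.
move=> [h fg]; elim/quotientW: c => c; rewrite !cohomology_map_pi.
apply/quotient_piP; exists (h i (val c)).
by rewrite linearB /= fg kernelP linear0 addr0.
Qed.

Lemma quasi_isomorphism_id X : quasi_isomorphism (chain_id X).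
Proof.
apply/quasi_isomorphismP; split=> i x dx0; first by case=> y; exists y.
by exists x, 0; rewrite linear0 addr0.
Qed.

Lemma quasi_isomorphism_comp X Y Z (f : chain_map Y Z) (g : chain_map X Y) :
  quasi_isomorphism f -> quasi_isomorphism g ->
  quasi_isomorphism (chain_comp f g).
Proof.
move=> qf qg i; apply: eq_bij (bij_comp (qf i) (qg i)) _ _ => c.
by rewrite cohomology_map_comp.
Qed.

Lemma quasi_isomorphism_homotopic X Y (f g : chain_map X Y) :
  homotopic f g -> quasi_isomorphism f -> quasi_isomorphism g.
Proof.
by move=> fg qf i; apply: eq_bij (qf i) _ _ => c; exact: cohomology_map_homotopic.
Qed.

Lemma quasi_isomorphism_cancel X Y Z (f : chain_map Y Z) (g : chain_map X Y) :
  quasi_isomorphism g -> quasi_isomorphism (chain_comp f g) ->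
  quasi_isomorphism f.
Proof.
move=> qg qfg i; have [g' g'K gK'] := qg i.
apply: eq_bij (bij_comp (qfg i) (Bijective gK' g'K)) _ _ => c /=.
by rewrite cohomology_map_comp gK'.
Qed.

End QuasiIsomorphisms.

(** * Mapping cones *)

Section Cones.
Variable R : nzRingType.
Implicit Types X Y A : complex R.

Section Sum.
Variables X Y : complex R.

Fact sum_diff_linear i :
  linear (fun p : X i * Y i => (diff X i p.1, diff Y i p.2)).
Proof. by move=> a [x y] [x' y'] /=; rewrite !linearP. Qed.

Definition sum_complex : complex R.
Proof.
exists (fun i => (X i * Y i)%type : lmodType R)
       (fun i => lin_of (@sum_diff_linear i)).
by move=> i [x y] /=; rewrite !diff_diff.
Defined.

End Sum.

Section Cone.
Variables (A Y : complex R) (f : chain_map A Y).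

Fact cone_diff_linear i :
  linear (fun p : Y i * A (i + 1)%R =>
    (diff Y i p.1 + f (i + 1) p.2, - diff A (i + 1) p.2)).
Proof.
move=> a [y x] [y' x'] /=; rewrite !linearP /=.
by congr pair; rewrite /= scalerDr addrACA.
Qed.

Definition cone : complex R.
Proof.
exists (fun i => (Y i * A (i + 1)%R)%type : lmodType R)
       (fun i => lin_of (@cone_diff_linear i)).
move=> i [y x] /=; congr pair; last by rewrite linearN diff_diff opprK.
by rewrite linearD diff_diff add0r linearN cmap_diff subrr.
Defined.

Fact cone_in_linear i : linear (fun y : Y i => (y, 0) : cone i).
Proof. by move=> a y y'; congr pair; rewrite /= scaler0 addr0. Qed.

Definition cone_in : chain_map Y cone.
Proof.
exists (fun i => lin_of (@cone_in_linear i)) => i y /=.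
by rewrite !linear0 addr0.
Defined.

Fact cone_homotopy_linear i : linear (fun x : A (i + 1) => (0, x) : cone i).
Proof. by move=> a x x'; congr pair; rewrite /= scaler0 addr0. Qed.

(** A null-homotopy of the composite A -> Y -> cone f. *)
Definition cone_homotopy i : {linear A (i + 1) -> cone i} :=
  lin_of (@cone_homotopy_linear i).

Lemma cone_homotopyP i (x : A (i + 1)) :
  diff cone i (cone_homotopy i x) + cone_homotopy (i + 1) (diff A (i + 1) x) =
  cone_in (i + 1) (f (i + 1) x).
Proof. by congr pair; rewrite /= ?linear0 ?addr0 ?add0r ?addNr. Qed.

Lemma cone_in_quasi_isomorphism : acyclic A -> quasi_isomorphism cone_in.
Proof.
move=> acA; apply/quasi_isomorphismP; split=> i.
  move=> y dy0 [[y' x] [yE /esym/eqP]]; rewrite oppr_eq0 => /eqP/acA[z xE].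
  by exists (y' + f i z); rewrite linearD -cmap_diff -xE.
move=> [y x] [dE /eqP]; rewrite oppr_eq0 => /eqP/acA[z xE].
exists (y + f (i + 1) z), (cone_homotopy i (- z)).
split; first by rewrite linearD -cmap_diff -xE.
by congr pair; rewrite /= ?linear0 ?linearN /= ?linear0 ?add0r ?addrK ?opprK.
Qed.

Lemma cone_acyclic : quasi_isomorphism f -> acyclic cone.
Proof.
move=> /quasi_isomorphismP[finj fsurj] i [y x] [yE /eqP].
rewrite oppr_eq0 => /eqP dx0.
have [|w xE] := finj _ x dx0.
  by exists (- y); apply/eqP; rewrite linearN -addr_eq0 [f _ x + _]addrC; exact/eqP.
have [|z [v [dz0 wE]]] := fsurj _ (y + f (i + 1) w).
  by rewrite linearD -cmap_diff -xE.
exists (v, z - w); congr pair; rewrite /= linearB /=.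
  by rewrite addrA [diff Y i v + _]addrC -wE addrK.
by rewrite dz0 sub0r opprK.
Qed.

End Cone.

(** The cone of (g, - s) : X -> Y + X' turns the square on [s] and [g] into a
    homotopy commutative one. *)
Section HomotopyPushout.
Variables (X X' Y : complex R) (s : chain_map X X') (g : chain_map X Y).

Fact span_linear i : linear (fun x : X i => (g i x, - s i x)).
Proof. by move=> a x x'; rewrite !linearP. Qed.

Definition span_map : chain_map X (sum_complex Y X').
Proof.
exists (fun i => lin_of (@span_linear i)) => i x /=.
by rewrite linearN !cmap_diff.
Defined.

Definition homotopy_pushout : complex R := cone span_map.

Fact inl_linear i : linear (fun y : Y i => (y, 0) : sum_complex Y X' i).
Proof. by move=> a y y'; congr pair; rewrite /= scaler0 addr0. Qed.

Fact inr_linear i : linear (fun x : X' i => (0, x) : sum_complex Y X' i).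
Proof. by move=> a x x'; congr pair; rewrite /= scaler0 addr0. Qed.

Definition sum_inl : chain_map Y (sum_complex Y X').
Proof. by exists (fun i => lin_of (@inl_linear i)) => i y /=; rewrite linear0. Defined.

Definition sum_inr : chain_map X' (sum_complex Y X').
Proof. by exists (fun i => lin_of (@inr_linear i)) => i y /=; rewrite linear0. Defined.

Definition pushout_inl : chain_map Y homotopy_pushout :=
  chain_comp (cone_in span_map) sum_inl.
Definition pushout_inr : chain_map X' homotopy_pushout :=
  chain_comp (cone_in span_map) sum_inr.

Lemma pushout_commutes :
  homotopic (chain_comp pushout_inr s) (chain_comp pushout_inl g).
Proof.
apply: homotopic_sym; exists (cone_homotopy span_map) => i x.
rewrite cone_homotopyP; congr pair; rewrite /= ?subr0 //.
by congr pair; rewrite ?subr0 ?sub0r.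
Qed.

(** Modulo [Y], the homotopy pushout is the cone of [s]. *)
Lemma pushout_inl_quasi_isomorphism :
  quasi_isomorphism s -> quasi_isomorphism pushout_inl.
Proof.
move=> /quasi_isomorphismP[sinj ssurj]; apply/quasi_isomorphismP; split=> i.
  move=> y dy0 [[[y' x'] x] [yE x'E /esym/eqP]]; rewrite oppr_eq0 => /eqP dx0.
  have [|w xE] := sinj _ x dx0.
    by exists x'; apply/esym/eqP; rewrite -subr_eq0; apply/eqP.
  by exists (y' + g i w); rewrite linearD -cmap_diff -xE.
move=> [[y x'] x] [yE x'E /eqP]; rewrite oppr_eq0 => /eqP dx0.
have [|w xE] := sinj _ x dx0.
  by exists x'; apply/esym/eqP; rewrite -subr_eq0; apply/eqP.
have [|z [v [dz0 wE]]] := ssurj _ (x' - s (i + 1) w).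
  by rewrite linearB -cmap_diff -xE.
exists (y + g (i + 1) (w + z)), ((0, v), - (w + z)); split.
  by rewrite !linearD -!cmap_diff dz0 linear0 addr0 -xE.
congr pair; first congr pair; rewrite /= ?linear0 !linearN /= ?opprK.
- by rewrite add0r addrK.
- by rewrite add0r linearD [diff X' i v + _]addrC -addrA -wE subrKC.
- by rewrite add0r linearD dz0 addr0.
Qed.

End HomotopyPushout.

(** A homotopy from f s to g s extends f - g to the cone of [s]; the cone of the
    extension is a target in which [f] and [g] become homotopic. *)
Section HomotopyCoequalizer.
Variables (X X' Y : complex R) (s : chain_map X X') (f g : chain_map X' Y).
Variable h : forall i, {linear X (i + 1) -> Y i}.
Hypothesis hP : forall i x, f (i + 1) (s (i + 1) x) - g (i + 1) (s (i + 1) x) =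
  diff Y i (h i x) + h (i + 1) (diff X (i + 1) x).

Fact difference_linear i :
  linear (fun p : cone s i => f i p.1 - g i p.1 + h i p.2).
Proof.
move=> a [y x] [y' x'] /=; rewrite !linearP /=.
by rewrite [X in X + _]addrACA -scalerDr addrACA -scalerDr.
Qed.

Definition difference_map : chain_map (cone s) Y.
Proof.
exists (fun i => lin_of (@difference_linear i)) => i [y x] /=.
by rewrite !linearD !linearN !cmap_diff /= addrACA hP addrA addrK.
Defined.

Definition homotopy_coequalizer : complex R := cone difference_map.

Lemma coequalizer_in_quasi_isomorphism :
  quasi_isomorphism s -> quasi_isomorphism (cone_in difference_map).
Proof. by move=> qs; apply/cone_in_quasi_isomorphism/cone_acyclic. Qed.

Fact coequalizer_homotopy_linear i :
  linear (fun x : X' (i + 1) => (x, 0) : cone s (i + 1)).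
Proof. by move=> a x x'; congr pair; rewrite /= scaler0 addr0. Qed.

Lemma coequalizer_in_coequalizes :
  homotopic (chain_comp (cone_in difference_map) f)
            (chain_comp (cone_in difference_map) g).
Proof.
exists (fun i => cone_homotopy difference_map i \o
                 lin_of (@coequalizer_homotopy_linear i)) => i x /=.
congr pair; first by rewrite /= !linear0 addr0 add0r addr0.
by congr pair; rewrite /= !linear0 ?addr0 ?addNr ?subrr.
Qed.

End HomotopyCoequalizer.

End Cones.

Section KbObjects.
Variables (R : nzRingType) (P : lmodType R -> Prop).
Hypothesis P_prod : forall V W, P V -> P W -> P (V * W)%type.

Lemma Kb_objects_sum (X Y : complex R) :
  Kb_objects P X -> Kb_objects P Y -> Kb_objects P (sum_complex X Y).
Proof.
move=> [[a [b X0]] PX] [[c [d Y0]] PY]; split; last by move=> i; exact: P_prod.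
exists (Num.min a c), (Num.max b d) => i iP [x y].
by congr pair; [apply: X0 | apply: Y0]; move: iP; lia.
Qed.

Lemma Kb_objects_cone (A Y : complex R) (f : chain_map A Y) :
  Kb_objects P A -> Kb_objects P Y -> Kb_objects P (cone f).
Proof.
move=> [[a [b A0]] PA] [[c [d Y0]] PY]; split; last by move=> i; exact: P_prod.
exists (Num.min (a - 1) c), (Num.max b d) => i iP [y x].
by congr pair; [apply: Y0 | apply: A0]; move: iP; lia.
Qed.

End KbObjects.

(** * Products of ideal powers and submodules *)

Section Spans.
Variables (R : nzRingType) (V : lmodType R).

Lemma submoduleN (N : set V) x : submodule N -> N x -> N (- x).
Proof. by move=> [_ _ NZ] Nx; rewrite -scaleN1r; exact: NZ. Qed.

Lemma submoduleB (N : set V) x y : submodule N -> N x -> N y -> N (x - y).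
Proof.
by move=> sN Nx Ny; have [_ ND _] := sN; apply: ND => //; exact: submoduleN.
Qed.

Lemma submodule_sum (N : set V) (J : Type) (r : seq J) (F : J -> V) (S : pred J) :
  submodule N -> (forall j, S j -> N (F j)) -> N (\sum_(j <- r | S j) F j).
Proof. by move=> [N0 ND _] FN; apply: (big_ind (fun x => N x)). Qed.

Lemma lin_span_submodule (s : seq V) : submodule (lin_span s).
Proof.
split.
- by exists (fun=> 0); rewrite big1 // => i _; rewrite scale0r.
- move=> _ _ [c ->] [d ->]; exists (fun i => c i + d i).
  by rewrite -big_split; apply: eq_bigr => i _; rewrite scalerDl.
- move=> a _ [c ->]; exists (fun i => a * c i).
  by rewrite scaler_sumr; apply: eq_bigr => i _; rewrite scalerA.
Qed.

Lemma mem_lin_span (s : seq V) x : x \in s -> lin_span s x.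
Proof.
move=> xs; have lt : (index x s < size s)%N by rewrite index_mem.
exists (fun i => if i == Ordinal lt then 1 else 0).
rewrite (bigD1 (Ordinal lt)) //= eqxx scale1r nth_index // big1 ?addr0 //.
by move=> i /negbTE ->; rewrite scale0r.
Qed.

Lemma lin_span_min (s : seq V) (N : set V) :
  submodule N -> (forall x, x \in s -> N x) -> forall x, lin_span s x -> N x.
Proof.
move=> sN Ns _ [c ->]; apply: submodule_sum => // i _.
by have [_ _ NZ] := sN; apply/NZ/Ns/mem_nth.
Qed.

(** For a two-sided ideal [A] this is the submodule A N. *)
Inductive set_mul (A : set R) (N : set V) : set V :=
  | set_mul0 : set_mul A N 0
  | set_mulD a x y : A a -> N x -> set_mul A N y -> set_mul A N (a *: x + y).

Lemma set_mul_add (A : set R) (N : set V) x y :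
  set_mul A N x -> set_mul A N y -> set_mul A N (x + y).
Proof.
move=> Ax Ay; elim: Ax => [|a z t Aa Nz _ IH]; first by rewrite add0r.
by rewrite -addrA; exact: set_mulD.
Qed.

Lemma mem_set_mul (A : set R) (N : set V) a x :
  A a -> N x -> set_mul A N (a *: x).
Proof. by move=> Aa Nx; rewrite -[_ *: _]addr0; exact: set_mulD (set_mul0 _ _). Qed.

Lemma set_mul_submodule (A : set R) (N : set V) :
  (forall b a, A a -> A (b * a)) -> submodule (set_mul A N).
Proof.
move=> AM; split; [exact: set_mul0 | exact: set_mul_add |].
move=> b x; elim=> [|a y z Aa Ny _ IH]; first by rewrite scaler0; exact: set_mul0.
by rewrite scalerDr scalerA; apply: set_mulD => //; exact: AM.
Qed.

Lemma set_mulS (A A' : set R) (N N' : set V) x :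
  (forall a, A a -> A' a) -> (forall y, N y -> N' y) ->
  set_mul A N x -> set_mul A' N' x.
Proof.
move=> AA NN; elim=> [|a y z Aa Ny _ IH]; first exact: set_mul0.
by apply: set_mulD => //; [exact: AA | exact: NN].
Qed.

Fixpoint combination (A : set R) (s : seq V) (x : V) : Prop :=
  if s is y :: s' then
    exists a z, [/\ A a, combination A s' z & x = a *: y + z]
  else x = 0.

(** The degree [n] part of the Rees submodule generated by homogeneous elements:
    an entry [(j, y)] stands for [y] placed in degree [j]. *)
Fixpoint gr_combination (I : ideal R) (n : nat) (G : seq (nat * V)) (x : V) : Prop :=
  if G is g :: G' then
    exists a z, [/\ (if (g.1 <= n)%N then ideal_exp I (n - g.1) a else a = 0),
      gr_combination I n G' z & x = a *: g.2 + z]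
  else x = 0.

End Spans.

Section Ideals.
Variables (R : nzRingType) (I : ideal R).

Lemma ideal_expMl n a b : ideal_exp I n b -> ideal_exp I n (a * b).
Proof. exact: (@ideal_exp_mulr R I 0 n). Qed.

Lemma ideal_expMr n a b : ideal_exp I n a -> ideal_exp I n (a * b).
Proof. by move=> Ia; rewrite -[n]addn0; exact: ideal_exp_mulr. Qed.

Lemma ideal_expS n a b : ideal_set I a -> ideal_exp I n b -> ideal_exp I n.+1 (a * b).
Proof.
move=> Ia Ib; exists [:: (a, b)]; rewrite big_seq1; split=> // p.
by rewrite inE => /eqP ->.
Qed.

Lemma ideal_exp_anti m n a : (m <= n)%N -> ideal_exp I n a -> ideal_exp I m a.
Proof.
move=> /subnK <-; elim: (n - m)%N a => [|d IH] a //= [s [sI ->]]; apply: IH.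
rewrite big_seq; apply: ideal_exp_sum => p /sI[_]; exact: ideal_expMl.
Qed.

Variable V : lmodType R.

Lemma ideal_exp_set_mulD m n (N : set V) x :
  submodule N -> set_mul (ideal_exp I (m + n)) N x ->
  set_mul (ideal_exp I m) (set_mul (ideal_exp I n) N) x.
Proof.
move=> sN; elim=> [|a y z aI Ny _ IH]; first exact: set_mul0.
apply: set_mul_add => // {z IH}.
elim: m a aI => [|m IHm] a aI.
  by rewrite -[a *: y]scale1r; apply: mem_set_mul => //; exact: mem_set_mul.
case: aI => s [sI ->]; rewrite scaler_suml big_seq.
have sM : submodule (set_mul (ideal_exp I m.+1) (set_mul (ideal_exp I n) N)).
  by apply: set_mul_submodule => b a' aI; exact: ideal_expMl.
apply: submodule_sum => // p /sI[p1 /IHm p2]; rewrite -scalerA.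
elim: p2 => [|b t u bI Nt _ IH].
  by rewrite scaler0; case: sM.
rewrite scalerDr; apply: set_mul_add => //; rewrite scalerA.
by apply: mem_set_mul => //; exact: ideal_expS.
Qed.

Lemma combination0 n (s : seq V) : combination (ideal_exp I n) s 0.
Proof.
elim: s => [|y s IH] //=; exists 0, 0.
by rewrite scale0r addr0; split=> //; exact: ideal_exp0.
Qed.

Lemma combinationD n (s : seq V) x x' :
  combination (ideal_exp I n) s x -> combination (ideal_exp I n) s x' ->
  combination (ideal_exp I n) s (x + x').
Proof.
elim: s x x' => [|y s IH] x x' /=; first by move=> -> ->; rewrite addr0.
move=> [a [z [aI sz ->]]] [a' [z' [aI' sz' ->]]]; exists (a + a'), (z + z').
split; [exact: ideal_expD | exact: IH | by rewrite scalerDl addrACA].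
Qed.

Lemma combinationZ m n (s : seq V) b x :
  ideal_exp I m b -> combination (ideal_exp I n) s x ->
  combination (ideal_exp I (m + n)) s (b *: x).
Proof.
move=> bI; elim: s x => [|y s IH] x /=; first by move=> ->; rewrite scaler0.
move=> [a [z [aI sz ->]]]; exists (b * a), (b *: z).
split; [exact: ideal_exp_mulr | exact: IH | by rewrite scalerDr scalerA].
Qed.

Lemma combination_submodule n (s : seq V) :
  submodule [set x | combination (ideal_exp I n) s x].
Proof.
split=> [|x y|a x]; [exact: combination0 | exact: combinationD |].
exact: (@combinationZ 0 n).
Qed.

Lemma mem_combination n (s : seq V) a x :
  ideal_exp I n a -> x \in s -> combination (ideal_exp I n) s (a *: x).
Proof.
move=> aI; elim: s => [|y s IH] //=; rewrite inE => /orP[/eqP ->|/IH sx].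
  by exists a, 0; rewrite addr0; split=> //; exact: combination0.
by exists 0, (a *: x); rewrite scale0r add0r; split=> //; exact: ideal_exp0.
Qed.

Lemma set_mul_combination n (s : seq V) x :
  [set: V] = lin_span s -> set_mul (ideal_exp I n) setT x ->
  combination (ideal_exp I n) s x.
Proof.
move=> sV; elim=> [|a y z aI _ _ IH]; first exact: combination0.
apply: combinationD => // {z IH}.
pose T := [set v | forall b, ideal_exp I n b ->
  combination (ideal_exp I n) s (b *: v)].
suff sT : lin_span s `<=` T by apply: sT => //; rewrite -sV.
apply: lin_span_min; last by move=> v sv b bI; exact: mem_combination.
split.
- by move=> b _; rewrite scaler0; exact: combination0.
- move=> v w Tv Tw b bI; rewrite scalerDr.
  by apply: combinationD; [exact: Tv | exact: Tw].
- by move=> c v Tv b bI; rewrite scalerA; apply: Tv; exact: ideal_expMr.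
Qed.

Lemma gr_combination0 n (G : seq (nat * V)) : gr_combination I n G 0.
Proof.
elim: G => [|g G IH] //=; exists 0, 0; rewrite scale0r addr0; split=> //.
by case: ifP => // _; exact: ideal_exp0.
Qed.

Lemma gr_combinationD n (G : seq (nat * V)) x x' :
  gr_combination I n G x -> gr_combination I n G x' ->
  gr_combination I n G (x + x').
Proof.
elim: G x x' => [|g G IH] x x' /=; first by move=> -> ->; rewrite addr0.
move=> [a [z [aI Gz ->]]] [a' [z' [aI' Gz' ->]]]; exists (a + a'), (z + z').
split; [|exact: IH | by rewrite scalerDl addrACA].
by case: ifP aI aI' => _; [exact: ideal_expD | move=> -> ->; rewrite addr0].
Qed.

Lemma gr_combinationZ m n (G : seq (nat * V)) b x :
  ideal_exp I m b -> gr_combination I n G x ->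
  gr_combination I (m + n) G (b *: x).
Proof.
move=> bI; elim: G x => [|g G IH] x /=; first by move=> ->; rewrite scaler0.
move=> [a [z [aI Gz ->]]]; exists (b * a), (b *: z).
split; [|exact: IH | by rewrite scalerDr scalerA].
case: (leqP g.1 n) aI => [le_gn aI|_ ->].
  by rewrite (leq_trans le_gn) ?leq_addl // -addnBA //; exact: ideal_exp_mulr.
by rewrite mulr0; case: ifP => // _; exact: ideal_exp0.
Qed.

Lemma mem_gr_combination (G : seq (nat * V)) g :
  g \in G -> gr_combination I g.1 G g.2.
Proof.
elim: G => [|h G IH] //=; rewrite inE => /orP[/eqP <-|/IH Gg].
  exists 1, 0; rewrite leqnn subnn scale1r addr0.
  by split=> //; exact: gr_combination0.
exists 0, g.2; rewrite scale0r add0r; split=> //.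
by case: ifP => // _; exact: ideal_exp0.
Qed.

Lemma gr_combination_cat n (G G' : seq (nat * V)) x x' :
  gr_combination I n G x -> gr_combination I n G' x' ->
  gr_combination I n (G ++ G') (x + x').
Proof.
move=> Gx Gx'; elim: G x Gx => [|g G IH] x /=; first by move=> ->; rewrite add0r.
move=> [a [z [aI Gz ->]]]; exists a, (z + x').
by split; [| exact: IH | rewrite addrA].
Qed.

Lemma gr_combination_submodule n (G : seq (nat * V)) :
  submodule [set x | gr_combination I n G x].
Proof.
split=> [|x y|a x]; [exact: gr_combination0 | exact: gr_combinationD |].
exact: (@gr_combinationZ 0 n).
Qed.

(** [N] is a graded submodule of V[T] over the Rees algebra. *)
Definition graded_submodule (N : nat -> set V) : Prop :=
  (forall n, submodule (N n)) /\
  forall m n a x, ideal_exp I m a -> N n x -> N (m + n)%N (a *: x).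

Definition graded_finitely_generated (N : nat -> set V) : Prop :=
  exists G : seq (nat * V), (forall g, g \in G -> N g.1 g.2) /\
    forall n x, N n x -> gr_combination I n G x.

End Ideals.

(** * The Artin-Rees property *)

Section ArtinRees.
Variables (R : nzRingType) (I : ideal R).
Hypothesis noeth : rees_graded_left_noetherian I.

(** Sequences of left ideals J_n of R inside I^n correspond to graded left ideals
    of the Rees algebra; the homogeneous components of generators of the latter
    generate in the graded sense. *)
Lemma rees_ideal_finitely_generated (J : nat -> set R^o) :
  graded_submodule I J -> (forall n a, J n a -> ideal_exp I n a) ->
  graded_finitely_generated I J.
Proof.
move=> [Jsub JM] JI.
pose S : set (rees I)^o := [set p : rees I | forall n, J n (val p)`_n].
have S_sub : submodule S.
  split.
  - by move=> n; rewrite coef0; case: (Jsub n).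
  - by move=> p q Sp Sq n; rewrite coefD; case: (Jsub n) => _ JD _; exact: JD.
  - move=> a p Sp n; rewrite [val _]/(val a * val p) coefM.
    apply: (@submodule_sum R R^o _ _ _ _ _ (Jsub n)) => i _.
    rewrite -{1}(subnKC (leq_ord i)).
    have /asboolP aI := valP a; exact: (JM i _ (val a)`_i _ (aI i) (Sp _)).
have [|s sE] := noeth (J := S).
  split=> // n p Sp m /=; rewrite coefZ coefXn.
  by case: eqP => [->|_]; rewrite ?mulr1 ?mulr0 //; case: (Jsub m).
pose G : seq (nat * R^o) :=
  flatten [seq [seq (j, (val p)`_j) | j <- iota 0 (size (val p))] | p : rees I <- s].
exists G; split=> [_ /flattenP[_ /mapP[p ps ->]] /mapP[j _ ->] /=|n a Ja].
  by have : S p; [rewrite sE; exact: mem_lin_span | exact].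
have p_rees : a *: 'X^n \in rees_pred I.
  apply/asboolP => m; rewrite coefZ coefXn.
  case: eqP => [->|_]; rewrite ?mulr1 ?mulr0; [exact: JI | exact: ideal_exp0].
have : lin_span s (Rees p_rees : (rees I)^o).
  rewrite -sE => m /=; rewrite coefZ coefXn.
  by case: eqP => [->|_]; rewrite ?mulr1 ?mulr0 //; case: (Jsub m).
pose T : set (rees I)^o :=
  [set p : rees I | forall n, gr_combination I n G ((val p)`_n : R^o)].
move=> /(@lin_span_min _ _ _ T) => /(_ _ _ n) /=; rewrite coefZ coefXn eqxx mulr1.
apply.
  split.
  - by move=> m; rewrite coef0; exact: gr_combination0.
  - by move=> p q Tp Tq m; rewrite coefD; exact: gr_combinationD.
  - move=> b p Tp m; rewrite [val _]/(val b * val p) coefM.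
    have Gsub := gr_combination_submodule I m G.
    apply: (@submodule_sum R R^o _ _ _ _ _ Gsub) => i _.
    rewrite /mkset -{1}(subnKC (leq_ord i)); have /asboolP bI := valP b.
    exact: (@gr_combinationZ _ _ R^o i _ G (val b)`_i _ (bI i) (Tp _)).
move=> p ps m; have [lt_m|le_m] := ltnP m (size (val p)).
  apply: (@mem_gr_combination _ _ R^o _ (m, (val p)`_m)).
  apply/flattenP; exists [seq (j, (val p)`_j) | j <- iota 0 (size (val p))].
    by apply/mapP; exists p.
  by apply/mapP; exists m; rewrite ?mem_iota.
by rewrite nth_default //; exact: gr_combination0.
Qed.

Variable V : lmodType R.

(** Induction on [s]: the coefficients of the first entry y are treated by the
    Rees algebra, and what remains after subtracting lifts of their generators
    is a combination of the other entries. *)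
Lemma graded_submodule_finitely_generated (s : seq V) (N : nat -> set V) :
  graded_submodule I N -> (forall n x, N n x -> combination (ideal_exp I n) s x) ->
  graded_finitely_generated I N.
Proof.
elim: s N => [|y s IH] N [Nsub NM] Ns.
  by exists [::]; split=> // n x /Ns.
pose J n : set R^o := [set a : R^o | ideal_exp I n a /\
  exists z, combination (ideal_exp I n) s z /\ N n (a *: y + z)].
have J_graded : graded_submodule I J.
  split=> [n|m n a b aI [bI [z [sz Nz]]]]; last first.
    split; first exact: ideal_exp_mulr.
    exists (a *: z); split; first exact: combinationZ.
    by rewrite -scalerA -scalerDr; exact: NM.
  have [N0 ND NZ] := Nsub n; split.
  - split; first exact: ideal_exp0.
    by exists 0; rewrite scale0r addr0; split=> //; exact: combination0.
  - move=> a b [aI [z [sz Nz]]] [bI [t [st Nt]]].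
    split; first exact: ideal_expD.
    exists (z + t); split; first exact: combinationD.
    by rewrite scalerDl addrACA; exact: ND.
  - move=> a b [bI [z [sz Nz]]]; split; first exact: ideal_expMl.
    exists (a *: z); split; first exact: (@combinationZ _ _ _ 0).
    by rewrite -scalerA -scalerDr; exact: NZ.
have [G [JG GJ]] : graded_finitely_generated I J.
  by apply: rees_ideal_finitely_generated => // n a [].
have N'_graded : graded_submodule I
    (fun n => N n `&` [set x | combination (ideal_exp I n) s x]).
  split=> [n|m n a x aI [Nx sx]]; last by split; [exact: NM | exact: combinationZ].
  have [N0 ND NZ] := Nsub n; have [s0 sD sZ] := combination_submodule I n s.
  split=> [|x x' [Nx sx] [Nx' sx']|a x [Nx sx]]; split=> //.
  - exact: ND.
  - exact: sD.
  - exact: NZ.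
  - exact: sZ.
have [|G' [NG' G'N]] := IH _ N'_graded; first by move=> n x [].
have /choice[w wP] (g : nat * R^o) : exists z, g \in G ->
    combination (ideal_exp I g.1) s z /\ N g.1 (g.2 *: y + z).
  by have [/JG[_ [z zP]]|_] := boolP (g \in G); [exists z | exists 0].
(* The lift to [N] of a generator of [J], still in degree g.1. *)
pose lift (g : nat * R^o) := (g.1, (g.2 : R) *: y + w g).
exists (map lift G ++ G'); split.
  move=> g; rewrite mem_cat => /orP[/mapP[h hG ->]|/NG'[]//].
  by have [] := wP h hG.
move=> n x Nx; have [a [z [aI sz xE]]] := Ns n x Nx.
have [v [Gv Nv [t [st vE]]]] : exists v, [/\ gr_combination I n (map lift G) v, N n v
    & exists t, combination (ideal_exp I n) s t /\ v = a *: y + t].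
  have : gr_combination I n G (a : R^o).
    by apply: GJ; split=> //; exists z; rewrite -xE.
  have : {subset G <= G} by [].
  elim: {1 3 4}G (a : R^o) => [|g H IHH] b /=.
    move=> _ ->; exists 0; split=> //; first by case: (Nsub n).
    by exists 0; rewrite scale0r addr0; split=> //; exact: combination0.
  move=> HG [c [b' [cI Hb' ->]]].
  have [|v [Hv Nv [t [st vE]]]] := IHH b' _ Hb'.
    by move=> h hH; apply: HG; rewrite inE hH orbT.
  have [sw Nw] := wP g (HG g (mem_head _ _)).
  have [N0 ND NZ] := Nsub n.
  have [cw cN] : combination (ideal_exp I n) s (c *: w g) /\
      N n (c *: (lift g).2).
    case: (leqP g.1 n) cI => [le_gn cI|_ ->].
      by rewrite -(subnK le_gn); split; [exact: combinationZ | exact: NM].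
    by rewrite !scale0r; split=> //; exact: combination0.
  exists (c *: (lift g).2 + v); split.
  - by exists c, v.
  - exact: ND.
  - exists (c *: w g + t); split; first exact: combinationD.
    by rewrite vE scalerDr scalerA addrACA -scalerDl.
rewrite -[x](subrKC v); apply: gr_combination_cat => //; apply: G'N; split.
  exact: submoduleB.
rewrite /= xE vE opprD addrACA subrr add0r.
by apply: (submoduleB (combination_submodule I n s)).
Qed.

Lemma graded_trace (s : seq V) (Z : set V) : submodule Z ->
  graded_submodule I
    (fun n => Z `&` [set x | combination (ideal_exp I n) s x]).
Proof.
move=> [Z0 ZD ZZ]; split=> [n|m n a x aI [Zx sx]]; last first.
  by split; [exact: ZZ | exact: combinationZ].
have [s0 sD sZ] := combination_submodule I n s.
split=> [|x x' [Zx sx] [Zx' sx']|a x [Zx sx]]; split=> //.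
- exact: ZD.
- exact: sD.
- exact: ZZ.
- exact: sZ.
Qed.

Hypothesis V_fg : fg_module V.

(** Degree 0 of [graded_trace] is [Z] itself, so R is left Noetherian. *)
Lemma submodule_finitely_generated (Z : set V) :
  submodule Z -> finitely_generated Z.
Proof.
move=> Zsub; have [s sV] := V_fg.
have [|G [ZG GZ]] :=
    graded_submodule_finitely_generated (s := s) (graded_trace s Zsub).
  by move=> n x [].
exists (map snd G); apply/seteqP; split=> x; last first.
  by apply: lin_span_min => // _ /mapP[g /ZG[Zg _] ->].
move=> Zx; have : gr_combination I 0 G x.
  by apply: GZ; split=> //; apply: set_mul_combination => //;
     rewrite -[x]scale1r; exact: mem_set_mul.
have : {subset G <= G} by [].
elim: {1 3}G x {Zx} => [|g H IH] x HG /=.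
  by move=> ->; case: (lin_span_submodule (map snd G)).
move=> [a [z [_ Hz ->]]].
have [_ GD GM] := lin_span_submodule (map snd G); apply: GD.
  by apply/GM/mem_lin_span/map_f/HG/mem_head.
by apply: IH Hz => h hH; apply: HG; rewrite inE hH orbT.
Qed.

(** Beyond the largest degree c of a generator, all coefficients in degree n + c
    lie in I^n. *)
Lemma artin_rees (Z : set V) : submodule Z ->
  exists c, forall n x, Z x -> set_mul (ideal_exp I (n + c)) setT x ->
    set_mul (ideal_exp I n) Z x.
Proof.
move=> Zsub; have [s sV] := V_fg.
have [|G [ZG GZ]] :=
    graded_submodule_finitely_generated (s := s) (graded_trace s Zsub).
  by move=> n x [].
exists (\max_(g <- G) g.1)%N => n x Zx /(set_mul_combination sV) sx.
have {sx Zx} : gr_combination I (n + \max_(g <- G) g.1) G x by apply: GZ.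
have : {subset G <= G} by [].
elim: {1 4}G x => [|g H IH] x HG /=; first by move=> ->; exact: set_mul0.
have Gg := HG g (mem_head _ _).
have le_g : (g.1 <= \max_(g <- G) g.1)%N.
  by rewrite (big_rem g Gg) leq_maxl.
move=> [a [z [aI Hz ->]]]; apply: set_mulD; last first.
- by apply: IH Hz => h hH; apply: HG; rewrite inE hH orbT.
- by case: (ZG g Gg).
move: aI; rewrite (leq_trans le_g) ?leq_addl // -addnBA //.
by apply: ideal_exp_anti; exact: leq_addr.
Qed.

End ArtinRees.

Section Torsion.
Variables (R : nzRingType) (I : ideal R) (V : lmodType R).

(** One exponent serves all generators; it serves their combinations too because
    the powers of I are also right ideals. *)
Lemma uniform_torsion (Z B : set V) :
  finitely_generated Z -> submodule B ->
  (forall x, Z x -> exists n, forall a, ideal_exp I n a -> B (a *: x)) ->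
  exists n, forall x, set_mul (ideal_exp I n) Z x -> B x.
Proof.
move=> [s ->] [B0 BD BZ] sB.
have [n nP] : exists n, forall x, x \in s ->
    forall a, ideal_exp I n a -> B (a *: x).
  have : {subset s <= s} by [].
  elim: {1 3}s => [|y t IH] ts; first by exists 0%N.
  have [|n nP] := IH; first by move=> x xt; apply: ts; rewrite inE xt orbT.
  have [m mP] := sB y (mem_lin_span (ts y (mem_head _ _))).
  exists (m + n)%N => x; rewrite inE => /orP[/eqP ->|xt] a aI.
    by apply: mP; exact: ideal_exp_anti (leq_addr _ _) aI.
  by apply: nP => //; exact: ideal_exp_anti (leq_addl _ _) aI.
exists n => x; elim=> [|a y z aI sy _ Bz] //; apply: (BD) => // {z Bz}.
pose T := [set v | forall b, ideal_exp I n b -> B (b *: v)].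
suff sT : lin_span s `<=` T by exact: sT.
apply: lin_span_min; last exact: nP.
split.
- by move=> b _; rewrite scaler0.
- by move=> v w Tv Tw b bI; rewrite scalerDr; apply: BD; [exact: Tv | exact: Tw].
- by move=> c v Tv b bI; rewrite scalerA; apply: Tv; exact: ideal_expMr.
Qed.

End Torsion.

(** * Quotient modules and quotient complexes *)

Section QuotientModules.
Variables (R : nzRingType) (V : lmodType R) (N : set V) (Nsub : submodule N).

Lemma quotient_pi_surj (q : quotient_module Nsub) : exists x, q = quotient_pi Nsub x.
Proof. by exists (repr q); rewrite quotient_repr. Qed.

Lemma quotient_pi_eq0 x : quotient_pi Nsub x = 0 <-> N x.
Proof.
by rewrite -(linear0 (quotient_pi Nsub)) -[in N x](subr0 x); exact: quotient_piP.
Qed.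

Lemma quotient_fg_module : fg_module V -> fg_module (quotient_module Nsub).
Proof.
move=> [s sV]; exists (map (quotient_pi Nsub) s); apply/seteqP; split=> // q _.
elim/quotientW: q => x.
have [s0 sD sZ] := lin_span_submodule (map (quotient_pi Nsub) s).
suff sub : lin_span s `<=`
    [set x | lin_span (map (quotient_pi Nsub) s) (quotient_pi Nsub x)].
  by apply: sub; rewrite -sV.
apply: lin_span_min => [|y sy]; last exact/mem_lin_span/map_f.
split=> [|y z sy sz|a y sy] /=.
- by rewrite linear0.
- by rewrite linearD; exact: sD.
- by rewrite linearZ; exact: sZ.
Qed.

Lemma quotient_torsion (I : ideal R) n :
  (forall x, set_mul (ideal_exp I n) setT x -> N x) ->
  torsion (quotient_module Nsub) I.
Proof.
move=> IN; elim/quotientW=> x; exists n.+1; split=> // a aI.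
apply: etrans (esym (quotient_piZ _ a x)) _; apply/quotient_pi_eq0.
by apply/IN/mem_set_mul => //; exact: ideal_exp_anti aI.
Qed.

End QuotientModules.

Section Products.
Variable R : nzRingType.

Lemma fg_module_prod (V W : lmodType R) :
  fg_module V -> fg_module W -> fg_module (V * W)%type.
Proof.
move=> [s sV] [t tW]; pose inl (v : V) : V * W := (v, 0).
pose inr (w : W) : V * W := (0, w); pose st := map inl s ++ map inr t.
have [st0 stD stZ] := lin_span_submodule st.
exists st; apply/seteqP; split=> // -[v w] _.
have -> : (v, w) = inl v + inr w by congr pair; rewrite /= ?addr0 ?add0r.
apply: (stD).
  suff sub : lin_span s `<=` [set x | lin_span st (inl x)] by apply: sub; rewrite -sV.
  apply: lin_span_min => [|y sy]; last first.
    by apply: mem_lin_span; rewrite mem_cat map_f.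
  split=> // [y z sy sz|a y sy] /=.
  - have -> : inl (y + z) = inl y + inl z by congr pair; rewrite /= addr0.
    exact: stD.
  - have -> : inl (a *: y) = a *: inl y by congr pair; rewrite /= scaler0.
    exact: stZ.
suff sub : lin_span t `<=` [set x | lin_span st (inr x)] by apply: sub; rewrite -tW.
apply: lin_span_min => [|y sy]; last first.
  by apply: mem_lin_span; rewrite mem_cat map_f ?orbT.
split=> // [y z sy sz|a y sy] /=.
- have -> : inr (y + z) = inr y + inr z by congr pair; rewrite /= addr0.
  exact: stD.
- have -> : inr (a *: y) = a *: inr y by congr pair; rewrite /= scaler0.
  exact: stZ.
Qed.

End Products.

Section QuotientComplex.
Variables (R : nzRingType) (X : complex R) (F : forall i, set (X i)).
Hypothesis F_sub : forall i, submodule (@F i).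
Hypothesis F_diff : forall i x, F x -> F (diff X i x).

Definition quotient_diff i (q : quotient_module (F_sub i)) :
    quotient_module (F_sub (i + 1)) :=
  quotient_pi (F_sub (i + 1)) (diff X i (repr q)).

Lemma quotient_diff_pi i x : quotient_diff (quotient_pi (F_sub i) x) =
  quotient_pi (F_sub (i + 1)) (diff X i x).
Proof.
apply/quotient_piP; rewrite -linearB; apply/F_diff/quotient_piP.
exact: quotient_repr.
Qed.

Fact quotient_diff_linear i : linear (@quotient_diff i).
Proof.
move=> a; elim/quotientW=> x; elim/quotientW=> y.
by rewrite -linearP !quotient_diff_pi -linearP linearP.
Qed.

Definition quotient_complex : complex R.
Proof.
exists (fun i => quotient_module (F_sub i) : lmodType R)
       (fun i => lin_of (@quotient_diff_linear i)) => i.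
by elim/quotientW=> x; rewrite /= !quotient_diff_pi diff_diff linear0.
Defined.

Definition quotient_map : chain_map X quotient_complex.
Proof.
exists (fun i => quotient_pi (F_sub i) : {linear X i -> quotient_module (F_sub i)}).
move=> i x /=.
by rewrite quotient_diff_pi.
Defined.

End QuotientComplex.

(** * Torsion quotients of complexes *)

Section TorsionQuotient.
Variables (R : nzRingType) (I : ideal R).
Hypothesis noeth : rees_graded_left_noetherian I.

(** Torsion cohomology, in terms of cocycles. *)
Definition torsion_cocycles (X : complex R) : Prop :=
  forall i (x : X (i + 1)), diff X (i + 1) x = 0 ->
  exists n, forall a, ideal_exp I n a -> exists y, a *: x = diff X i y.

Lemma torsion_cohomology_cocycles (X : complex R) :
  (forall i, torsion (cohomology X i) I) -> torsion_cocycles X.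
Proof.
move=> tX i x dx0; have x_ker : x \in ker_pred (diff X (i + 1)) by apply/eqP.
have [n [_ nP]] := tX i (quotient_pi (boundaries_submodule X i) (Kernel x_ker)).
exists n => a /nP ax0; have ax := etrans (quotient_piZ _ a (Kernel x_ker)) ax0.
by have [y yE] := (quotient_pi_eq0 _ _).1 ax; exists y.
Qed.

Lemma torsion_cocycles_quasi_isomorphism (X Y : complex R) (f : chain_map X Y) :
  quasi_isomorphism f -> torsion_cocycles X -> torsion_cocycles Y.
Proof.
move=> /quasi_isomorphismP[_ fsurj] tX i y dy0.
have [x [z [dx0 ->]]] := fsurj i y dy0; have [n nP] := tX i x dx0.
exists n => a /nP[t tE]; exists (f i t + a *: z).
by rewrite scalerDr -linearZ tE cmap_diff linearD linearZ.
Qed.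

Lemma torsion_cocycles_terms (X : complex R) :
  (forall i, torsion (X i) I) -> torsion_cocycles X.
Proof.
move=> tX i x _; have [n [_ nP]] := tX (i + 1) x.
by exists n => a /nP ->; exists 0; rewrite linear0.
Qed.

(** Artin-Rees turns membership in I^(n+m+c) X into membership in I^n I^m Z, where
    Z are the cocycles, and I^m Z consists of boundaries. *)
Lemma adic_exactness (X : complex R) i :
  fg_module (X (i + 1)) -> torsion_cocycles X ->
  exists e, forall n (x : X (i + 1)), diff X (i + 1) x = 0 ->
    set_mul (ideal_exp I (n + e)) setT x ->
    exists y, set_mul (ideal_exp I n) setT y /\ x = diff X i y.
Proof.
move=> fgX tX; pose Z := [set x | diff X (i + 1) x = 0].
pose B := [set x | exists y, x = diff X i y].
have Zsub : submodule Z.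
  split=> [|x y xZ yZ|a x xZ]; rewrite /Z /= ?linear0 ?linearD ?linearZ //=.
    by rewrite xZ yZ addr0.
  by rewrite xZ scaler0.
have Bsub : submodule B.
  split=> [|x y [t ->] [u ->]|a x [t ->]].
  - by exists 0; rewrite linear0.
  - by exists (t + u); rewrite linearD.
  - by exists (a *: t); rewrite linearZ.
have [c cP] := artin_rees noeth fgX Zsub.
have Zfg := submodule_finitely_generated noeth fgX Zsub.
have [m mP] := uniform_torsion Zfg Bsub (tX i).
exists (m + c)%N => n x dx0; rewrite addnA => /(cP _ _ dx0).
move=> /(ideal_exp_set_mulD Zsub) /(set_mulS (fun a => id) mP).
elim=> [|a y z aI [t ->] _ [u [uI ->]]].
  by exists 0; rewrite linear0; split=> //; exact: set_mul0.
exists (a *: t + u); rewrite linearP; split=> //; exact: set_mulD.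
Qed.

Section Truncation.
Variables (X : complex R) (n : int -> nat).

(** The subcomplex generated by the I^(n i) X^i; the transport along j + 1 = i
    makes it defined in every degree, not only in the form i + 1. *)
Definition adic_part i : set (X i) :=
  [set x | exists u j (ji : j + 1 = i) v, [/\ set_mul (ideal_exp I (n i)) setT u,
     set_mul (ideal_exp I (n j)) setT v & x = u + ecast i (X i) ji (diff X j v)]].

Lemma adic_partS i (x : X (i + 1)) : adic_part x <->
  exists u v, [/\ set_mul (ideal_exp I (n (i + 1))) setT u,
    set_mul (ideal_exp I (n i)) setT v & x = u + diff X i v].
Proof.
split=> [[u [j [ji [v [uI vI ->]]]]]|[u [v [uI vI ->]]]]; last first.
  by exists u, i, erefl, v.
have ij : j = i by apply: addIr ji.
by subst j; rewrite (eq_irrelevance ji erefl); exists u, v.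
Qed.

Lemma adic_part_submodule i : submodule (@adic_part i).
Proof.
rewrite -[i](subrK 1); set j := i - 1.
have sub m l : submodule (set_mul (ideal_exp I m) [set: X l]).
  by apply: set_mul_submodule => b a; exact: ideal_expMl.
have [u0 uD uZ] := sub (n (j + 1)) (j + 1); have [v0 vD vZ] := sub (n j) j.
split.
- by apply/adic_partS; exists 0, 0; rewrite linear0 addr0.
- move=> x y /adic_partS[u [v [uI vI ->]]] /adic_partS[u' [v' [uI' vI' ->]]].
  apply/adic_partS; exists (u + u'), (v + v'); split; [exact: uD | exact: vD |].
  by rewrite linearD addrACA.
- move=> a x /adic_partS[u [v [uI vI ->]]].
  apply/adic_partS; exists (a *: u), (a *: v); split; [exact: uZ | exact: vZ |].
  by rewrite scalerDr linearZ.
Qed.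

Lemma adic_part_diff i x : @adic_part i x -> adic_part (diff X i x).
Proof.
move=> [u [j [ji [v [uI vI ->]]]]] {x}; apply/adic_partS; exists 0, u.
split=> //; first exact: set_mul0.
rewrite add0r linearD; case: i / ji u uI => u _ /=.
by rewrite diff_diff addr0.
Qed.

Definition adic_quotient : complex R :=
  quotient_complex adic_part_submodule adic_part_diff.

Definition adic_quotient_map : chain_map X adic_quotient :=
  quotient_map adic_part_submodule adic_part_diff.

(** The hypothesis makes the subcomplex acyclic: a cocycle u + d v of it has u a
    cocycle, hence u = d w with w in the term of degree i. *)
Lemma adic_quotient_quasi_isomorphism :
  (forall i (x : X (i + 1)), diff X (i + 1) x = 0 ->
     set_mul (ideal_exp I (n (i + 1))) setT x ->
     exists y, set_mul (ideal_exp I (n i)) setT y /\ x = diff X i y) ->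
  quasi_isomorphism adic_quotient_map.
Proof.
move=> exact_n; apply/quasi_isomorphismP; split=> i.
  move=> x dx0 [q]; have [y ->] := quotient_pi_surj q.
  rewrite [RHS](quotient_diff_pi _ adic_part_diff) => /quotient_piP xyP.
  have [u [v [uI vI xE]]] := (adic_partS _).1 xyP.
  have [|w [_ wE]] := exact_n i u _ uI.
    apply/eqP; rewrite -(addrK (diff X i v) u) -xE !linearB /= dx0 !diff_diff.
    by rewrite !subr0.
  by exists (y + w + v); rewrite !linearD -wE -addrA -xE addrC subrK.
move=> q; have [y ->] := quotient_pi_surj q.
rewrite [LHS](quotient_diff_pi _ adic_part_diff).
rewrite -[RHS](linear0 (quotient_pi (adic_part_submodule (i + 1 + 1)))).
move=> /quotient_piP; rewrite subr0 => dyP.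
have [u [v [uI vI dyE]]] := (adic_partS _).1 dyP.
have [|w [wI wE]] := exact_n _ u _ uI.
  apply/eqP; rewrite -(addrK (diff X _ v) u) -dyE !linearB /= !diff_diff.
  by rewrite subr0.
exists (y - v - w), 0; split.
  by rewrite !linearB /= dyE -wE addrK subrr.
rewrite linear0 addr0; apply/quotient_piP.
rewrite -addrA -opprD subKr.
apply/adic_partS; exists (v + w), 0; split; [exact: set_mul_add | exact: set_mul0 |].
by rewrite linear0 addr0.
Qed.

End Truncation.

(** The exponents n_i are the partial sums of the shifts of [adic_exactness] from
    a - 1 on, where X^i vanishes below degree a. *)
Lemma torsion_quotient (X : complex R) :
  Kb_objects (@fg_module R) X -> torsion_cocycles X ->
  exists (X' : complex R) (q : chain_map X X'),
    Kb_objects (fg_torsion_module I) X' /\ quasi_isomorphism q.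
Proof.
move=> [[a [b X0]] fgX] tX.
have /choice[e eP] i := adic_exactness (fgX (i + 1)) tX.
pose n (i : int) : nat := (\sum_(k < absz (i - a + 1)%R) e (a - 1 + k%:Z)%R)%N.
exists (adic_quotient X n), (adic_quotient_map X n); split; last first.
  apply: adic_quotient_quasi_isomorphism => i x dx0 xI.
  have [lt_ia|le_ai] := ltP (i + 1) a.
    exists 0; rewrite linear0; split; first exact: set_mul0.
    by apply: X0; rewrite lt_ia.
  apply: eP dx0 _; rewrite (_ : (n i + e i)%N = n (i + 1)) // /n.
  rewrite (_ : absz (i + 1 - a + 1)%R = (absz (i - a + 1)%R).+1); last lia.
  rewrite big_ord_recr /=; congr (_ + e _)%N; lia.
split; last first.
  move=> i; split; first exact: quotient_fg_module.
  apply: (@quotient_torsion _ _ _ _ _ (n i)) => x xI.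
  exists x, (i - 1), (subrK 1 i), 0; split=> //; first exact: set_mul0.
  rewrite linear0.
  have -> (j l : int) (jl : j = l) : ecast l (X l) jl (0 : X j) = 0 by case: l / jl.
  by rewrite addr0.
exists a, b => i iP; elim/quotientW=> x.
by rewrite (X0 i iP x) linear0.
Qed.

End TorsionQuotient.

(** * The equivalence of derived categories *)

Section Equivalence.
Variables (R : nzRingType) (I : ideal R).
Hypothesis noeth : rees_graded_left_noetherian I.

Let P : homotopy_category R -> Prop := Kb_objects (@fg_module R).
Let Q : homotopy_category R -> Prop := Kb_objects (fg_torsion_module I).
Let W : morphism_class (homotopy_category R) := @quasi_isomorphism R.

Let QP X : Q X -> P X := @Kb_objects_mono _ _ _ (fun V => @proj1 _ _) X.

Lemma torsion_square (X X' Y : homotopy_category R) (s : hom X X') (g : hom X Y) :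
  P X -> P X' -> Q Y -> W s ->
  exists (Y' : homotopy_category R) (k : hom X' Y') (u : hom Y Y'),
    [/\ Q Y', W u & heq (hcomp k s) (hcomp u g)].
Proof.
move=> PX PX' QY Ws.
have qu := pushout_inl_quasi_isomorphism g Ws.
have [||Y' [q [QY' qq]]] := @torsion_quotient R I noeth (homotopy_pushout s g).
- apply: Kb_objects_cone => //; [exact: fg_module_prod|].
  apply: Kb_objects_sum => //; [exact: fg_module_prod|exact: QP].
- apply: torsion_cocycles_quasi_isomorphism qu _.
  by apply: torsion_cocycles_terms => i; case: QY => _ /(_ i)[].
exists Y', (chain_comp q (pushout_inr s g)), (chain_comp q (pushout_inl s g)).
split=> //; first exact: quasi_isomorphism_comp.
exact: (homotopic_comp (@homotopic_eq _ _ _ q q (fun _ _ => erefl))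
  (pushout_commutes s g)).
Qed.

Lemma torsion_coequalizer (X X' Y : homotopy_category R) (s : hom X X')
    (f g : hom X' Y) :
  P X -> P X' -> Q Y -> W s -> heq (hcomp f s) (hcomp g s) ->
  exists (Y' : homotopy_category R) (u : hom Y Y'),
    [/\ Q Y', W u & heq (hcomp u f) (hcomp u g)].
Proof.
move=> PX PX' QY Ws [h hP].
have qu := coequalizer_in_quasi_isomorphism hP Ws.
have [||Y' [q [QY' qq]]] := @torsion_quotient R I noeth (homotopy_coequalizer hP).
- apply: Kb_objects_cone => //; [exact: fg_module_prod| |exact: QP].
  by apply: Kb_objects_cone => //; exact: fg_module_prod.
- apply: torsion_cocycles_quasi_isomorphism qu _.
  by apply: torsion_cocycles_terms => i; case: QY => _ /(_ i)[].
exists Y', (chain_comp q (cone_in (difference_map hP))).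
split=> //; first exact: quasi_isomorphism_comp.
exact: (homotopic_comp (@homotopic_eq _ _ _ q q (fun _ _ => erefl))
  (coequalizer_in_coequalizes hP)).
Qed.

Theorem Phi_equivalence : is_equivalence (Phi I).
Proof.
have W_id (X : homotopy_category R) : W (idm X) by exact: quasi_isomorphism_id.
have W_comp (X Y Z : homotopy_category R) (f : hom Y Z) (g : hom X Y) :
  W f -> W g -> W (hcomp f g) by exact: quasi_isomorphism_comp.
have W_heq (X Y : homotopy_category R) (f g : hom X Y) : heq f g -> W f -> W g.
  exact: quasi_isomorphism_homotopic.
have W_cancel (X Y Z : homotopy_category R) (f : hom Y Z) (g : hom X Y) :
  W g -> W (hcomp f g) -> W f by exact: quasi_isomorphism_cancel.
apply: fully_faithful_equivalence.
- move=> X Y f.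
  exact: (@localization_inclusion_full _ W P Q QP W_id W_comp torsion_square X Y f).
- move=> X Y f g.
  exact: (@localization_inclusion_faithful _ W P Q QP W_id W_comp W_heq W_cancel
    torsion_square torsion_coequalizer X Y f g).
move=> [[X PX] tX].
have [X' [q [QX' qq]]] := torsion_quotient noeth PX (torsion_cohomology_cocycles tX).
pose x' : Kb (fg_torsion_module I) := exist _ X' QX'.
pose x : Kb (@fg_module R) := exist _ X PX.
pose Fx' : Kb (@fg_module R) := Kb_inclusion (fun V => @proj1 _ _) x'.
pose e' := @lhom_in _ (@Kb_quasi_isomorphism R (@fg_module R)) x Fx' q.
pose e := @lhom_inv _ (@Kb_quasi_isomorphism R (@fg_module R)) x Fx' q qq.
pose qW : Kb_quasi_isomorphism (q : hom x Fx') := qq.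
by exists x', e, e'; split; [exact: (lheq_invl qW) | exact: (lheq_invr qW)].
Qed.

End Equivalence.

Theorem proposition1p2 (k : fieldType) (L : finDimLieAlgType k) :
  rees_graded_left_noetherian (aug_ideal L) ->
  is_equivalence (Phi (aug_ideal L)).
Proof. exact: Phi_equivalence. Qed.
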